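(* Let $X\subset\mathcal{A}^{\mathbb{Z}}$ be a subshift over a finite alphabet $\mathcal{A}$. Suppose that: (1) there exists a constant $C$ so that $|\mathcal{L}_n(X)| < Ce^{nh(X)}$ for all $n$; (2) there exist $G \subset \mathcal{L}(X)$ and an integer $R \ge 0$ such that for all $v, w \in G$ there exists $y \in \mathcal{A}^R$ with $vyw \in \mathcal{L}(X)$; and (3) for every ergodic measure of maximal entropy $\mu$ on $X$, there exist $\epsilon > 0$ and a syndetic set $S\subseteq\mathbb{N}$ so that $\mu(G_n) > \epsilon$ for every $n \in S$. Then $X$ has a unique measure of maximal entropy.
   Context: A subshift is a (nonempty) closed subset $X$ of $\mathcal{A}^{\mathbb{Z}}$ ($\mathcal{A}$ finite, product topology) invariant under the shift $(\sigma x)_n=x_{n+1}$. $\mathcal{L}(X)$ is the set of all finite words appearing in points of $X$, and $\mathcal{L}_n(X)$ is the set of those of length $n$. $\mathcal{A}^R$ is the set of words of length $R$; $vyw$ denotes concatenation. The topological entropy is $h(X)=\lim_{n\to\infty}\frac1n\log|\mathcal{L}_n(X)|$ (natural logarithm). For a set $G$ of words, $G_n$ is the set of words in $G$ of length $n$. For $w\in\mathcal{L}_n(X)$, $[w]=\{x\in X: x_1\ldots x_n=w\}$, and for a measure $\mu$ on $X$, $\mu(G_n):=\mu\left(\bigcup_{w\in G_n}[w]\right)$. A measure of maximal entropy (MME) on $X$ is a $\sigma$-invariant Borel probability measure $\mu$ supported on $X$ with measure-theoretic entropy $h(\mu)=\lim_n -\frac1n\sum_{w\in\mathcal{A}^n}\mu([w])\log\mu([w])$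 equal to $h(X)$. A set $S\subseteq\mathbb{N}$ is syndetic if there exists $N$ so that $\{k,\ldots,k+N-1\}\cap S\neq\varnothing$ for every $k$. *)

(* Defs.v *)
From HB Require Import structures.
From mathcomp Require Import all_boot all_order all_algebra.
From mathcomp Require Import all_classical all_reals all_analysis.

Set Implicit Arguments.
Unset Strict Implicit.
Unset Printing Implicit Defensive.

Import Order.TTheory GRing.Theory Num.Theory.
Import numFieldNormedType.Exports.

Local Open Scope classical_set_scope.
Local Open Scope ring_scope.

(* measurableType requires an inhabited carrier, hence the distinguished letter:
   it plays no role, and an alphabet carrying a nonempty subshift has one. *)
#[short(type="alphabetType")]
HB.structure Definition Alphabet := {A of Finite A & isPointed A}.

Definition full_shift (A : alphabetType) : Type :=
  prod_topology (fun _ : int => discrete_topology A).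

HB.instance Definition _ (A : alphabetType) := Pointed.on (full_shift A).
HB.instance Definition _ (A : alphabetType) := Topological.on (full_shift A).
HB.instance Definition _ (A : alphabetType) :=
  Measurable.copy (full_shift A)
    (g_sigma_algebraType (@open (full_shift A))).

Section Words.
Context {A : alphabetType}.
Implicit Types (x : full_shift A) (X : set (full_shift A)) (w : seq A).

Definition left_shift x : full_shift A := fun i => x (i + 1).

(* Invariance is equality: a closed X with only left_shift @` X `<=` X may have
   words that no shift-invariant measure sees. *)
Definition subshift X := [/\ X !=set0, closed X & left_shift @` X = X].

(* The word x_i ... x_(i+n-1). *)
Definition subword x (i : int) (n : nat) : seq A :=
  mkseq (fun j => x (i + j%:Z)) n.

Definition language X : set (seq A) :=
  [set w | exists x i, X x /\ subword x i (size w) = w].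

Definition language_card X (n : nat) : nat :=
  #|[pred w : n.-tuple A | `[< language X w >]]|.

Definition cylinder X w : set (full_shift A) :=
  [set x | X x /\ subword x 1 (size w) = w].

Definition words_of_length (G : set (seq A)) (n : nat) : set (seq A) :=
  [set w | G w /\ size w = n].

Definition top_entropy (R : realType) X : R :=
  limn (fun n => n%:R^-1 * ln (language_card X n)%:R).

End Words.

Section Measures.
Context {R : realType} {A : alphabetType}.
Implicit Types (X : set (full_shift A)) (mu nu : probability (full_shift A) R).

Definition shift_invariant mu :=
  forall B, measurable B -> mu (left_shift @^-1` B) = mu B.

Definition ergodic mu := shift_invariant mu /\
  forall B, measurable B -> left_shift @^-1` B = B -> mu B = 0%E \/ mu B = 1%E.

(* Here 0 * ln 0 = 0, as the formula requires. *)
Definition measure_entropy X mu : R :=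
  limn (fun n => - (n%:R^-1 * \sum_(w : n.-tuple A)
    fine (mu (cylinder X w)) * ln (fine (mu (cylinder X w))))).

Definition max_entropy_measure X mu :=
  [/\ shift_invariant mu, mu X = 1%E & measure_entropy X mu = top_entropy R X].

(* Values on nonmeasurable sets are junk, so Leibniz equality of the functions
   mu and nu would be too strong. *)
Definition same_measure mu nu := forall B, measurable B -> mu B = nu B.

Definition measure_of_words X mu (G : set (seq A)) (n : nat) : \bar R :=
  mu (\bigcup_(w in words_of_length G n) cylinder X w).

End Measures.

Definition syndetic (S : set nat) :=
  exists N, forall k, exists2 j, (k <= j < k + N)%N & S j.

(* Main.v *)
Require Import Defs.
From HB Require Import structures.
From mathcomp Require Import all_boot all_order all_algebra.
From mathcomp Require Import all_classical all_reals all_analysis.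
From mathcomp Require Import ring lra zify.

(** Let h be the topological entropy and L_n the number of words of length n in
    the language. Submultiplicativity and the growth hypothesis give
    exp (n h) <= L_n <= C exp (n h). This two-sided bound makes counting and
    entropy interchangeable up to constants: a set of words of length n whose
    measure is at least e for some measure of maximal entropy contains at least
    a fixed proportion, depending on e and C alone, of exp (n h) words
    ([mme_wcard_ge], from Gibbs' inequality).

    Uniqueness among ergodic measures ([ergodic_mme_same]). Two different ergodic
    measures mu and nu are mutually singular, so some condition Q on a window has
    measure close to 1 for mu and close to 0 for nu. Gluing a mu-typical word of
    G to a nu-typical word of G, one obtains words in which the switch from mu to
    nu happens at a chosen place. Words with switches at sufficiently distant
    places are different, and for each place there are at least b exp (n h) of
    them. Allowing more than C / b places contradicts the upper bound on L_n. No
    pointwise ergodic theorem is involved: mutual singularity comes from a Hahn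
    decomposition of mu - nu made invariant by a limit superior along the orbit
    ([ergodic_separation]).

    Reduction to ergodic measures ([mme_ergodic]). Conditioning a measure of
    maximal entropy on an invariant set of positive measure preserves maximality
    of entropy. Disjoint invariant sets yield disjoint large sets of words, so
    there are boundedly many of them and each contains an indivisible one. The
    conditional measures on indivisible sets are ergodic measures of maximal
    entropy, hence coincide, hence there is only one indivisible set and it has
    full measure: every measure of maximal entropy is ergodic.

    Existence ([mme_exists]). Average the empirical measures of points showing
    the words of length n, and take a limit along an ultrafilter. The limit is a
    finitely additive invariant probability; on sets depending on finitely many
    coordinates compactness makes it countably additive, so it extends to a
    Borel measure. A word u of length k occurs at a given place in at most
    C^2 exp ((n - k) h) words of length n, so u receives measure at most
    C^2 exp (- k h), and the entropy of words of length k is at least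
    k h - ln (C^2). *)

Set Implicit Arguments.
Unset Strict Implicit.
Unset Printing Implicit Defensive.

Import Order.TTheory GRing.Theory Num.Theory.
Import numFieldNormedType.Exports.

Local Open Scope classical_set_scope.
Local Open Scope ring_scope.

(** * Subadditive sequences and Gibbs' inequality *)

Section RealLemmas.
Context {R : realType}.

Lemma subadditive_muln (a : nat -> R) :
  (forall n, 0 <= a n) -> (forall m n, a (m + n)%N <= a m + a n) ->
  forall m q r, a (q * m + r)%N <= q%:R * a m + a r.
Proof.
move=> a0 asub m q r; elim: q => [|q ih]; first by rewrite mul0n add0n mul0r add0r.
rewrite mulSn -addnA (le_trans (asub _ _))// -natr1 mulrDl mul1r.
by move: ih; lra.
Qed.

(** Dividing n by a nearly optimal m with remainder bounds a n / n by
    a m / m up to O(1 / n), so a n / n tends to its infimum. Both the growth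
    rate of the language and the entropy of a measure are limits of this kind;
    the second conclusion turns them into bounds valid at every length. *)
Lemma fekete (a : nat -> R) :
  (forall n, 0 <= a n) -> (forall m n, a (m + n)%N <= a m + a n) ->
  exists2 l : R, (fun n => n%:R^-1 * a n) @ \oo --> l & forall n, n%:R * l <= a n.
Proof.
move=> a0 asub.
pose S := [set (n.+1)%:R^-1 * a n.+1 | n in [set: nat]].
have Slb : lbound S 0 by move=> _ [n _ <-]; rewrite mulr_ge0 ?invr_ge0.
have Sinf : has_inf S by split; [exists (1%:R^-1 * a 1%N); exists 0%N|exists 0].
have infle n : n%:R * inf S <= a n.
  case: n => [|n]; first by rewrite mul0r.
  rewrite -ler_pdivlMl ?ltr0n//.
  by apply: ge_inf; [exists 0|exists n].
exists (inf S) => //.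
apply/cvgrPdist_le => e e0.
have e20 : 0 < e / 2 by rewrite divr_gt0.
have [_ [m _ <-] hm] := inf_adherent e20 Sinf.
move: hm; set M := m.+1 => hM.
pose B := \sum_(r < M) a r.
have aB r : (r < M)%N -> a r <= B.
  move=> rM; rewrite /B (bigD1 (Ordinal rM))//= lerDl; exact: sumr_ge0.
have B0 : 0 <= B by exact: sumr_ge0.
near=> n.
have n0 : (0 < n)%N by near: n; exists 1%N.
have nR0 : (0 : R) < n%:R by rewrite ltr0n.
have Bn : B <= (e / 2) * n%:R.
  rewrite mulrC -ler_pdivrMr ?divr_gt0//.
  apply/ltW/(lt_le_trans (archi_boundP _)); first by rewrite divr_ge0// divr_ge0// ltW.
  by rewrite ler_nat; near: n; exact: nbhs_infty_ge.
have lo : inf S <= n%:R^-1 * a n by rewrite ler_pdivlMl.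
rewrite ler0_norm ?subr_le0// opprB lerBlDl ler_pdivrMl//.
rewrite {1}(divn_eq n M); apply: (le_trans (subadditive_muln a0 asub _ _ _)).
have aM : a M <= M%:R * (inf S + e / 2).
  by rewrite -ler_pdivrMl ?ltr0n// ltW.
have /aB rB : (n %% M < M)%N by rewrite ltn_mod.
have q0 : (0 : R) <= (n %/ M)%:R by [].
have := ler_wpM2l q0 aM.
have inf0 : 0 <= inf S by apply: lb_le_inf => //; case: Sinf.
have : ((n %/ M)%:R * M%:R : R) <= n%:R by rewrite -natrM ler_nat leq_trunc_div.
move=> qM h1.
have := ler_wpM2r (addr_ge0 inf0 (ltW e20) : 0 <= inf S + e / 2) qM.
lra.
Unshelve. all: by end_near. Qed.

Lemma ln_le_sub1 (x : R) : 0 < x -> ln x <= x - 1.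
Proof.
move=> x0; rewrite -{1}(subrK 1 x) addrC; apply: le_ln1Dx; lra.
Qed.

(** This is ln x <= x - 1 at x = q t / p t, weighted by p t. Each upper bound on
    an entropy below comes from a suitable choice of the comparison weights q. *)
Lemma gibbs (T : finType) (p q : T -> R) :
  (forall t, 0 <= p t) -> (forall t, 0 <= q t) ->
  (forall t, q t = 0 -> p t = 0) -> \sum_t q t <= \sum_t p t ->
  - \sum_t p t * ln (p t) <= - \sum_t p t * ln (q t).
Proof.
move=> p0 q0 qp sumqp; rewrite lerN2 -subr_ge0 -sumrB.
apply: (@le_trans _ _ (\sum_t (p t - q t))); first by rewrite sumrB subr_ge0.
apply: ler_sum => t _.
have := p0 t; rewrite le_eqVlt => /predU1P[<-|pt]; first by rewrite !mul0r !sub0r oppr0 oppr_le0.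
have qt : 0 < q t.
  rewrite lt_neqAle q0 andbT; apply/eqP => /esym/qp pE; by rewrite pE ltxx in pt.
have := ler_wpM2l (ltW pt) (ln_le_sub1 (divr_gt0 qt pt)).
rewrite ln_div ?posrE// mulrBr mulrBr mulrCA divff ?gt_eqF//.
lra.
Qed.
End RealLemmas.

(** * Finite measures with real values *)

Section RealMeasure.
Context d (T : measurableType d) (R : realType) (mu : {finite_measure set T -> \bar R}).
Implicit Types B C : set T.

Definition pr (m : set T -> \bar R) B : R := fine (m B).

Lemma prE B : measurable B -> mu B = (pr mu B)%:E.
Proof. by move=> mB; rewrite /pr fineK// fin_num_measure. Qed.

Lemma pr_ge0 B : 0 <= pr mu B.
Proof. by rewrite /pr fine_ge0. Qed.

Lemma pr_set0 : pr mu set0 = 0.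
Proof. by rewrite /pr measure0. Qed.

Lemma pr_le B C : measurable B -> measurable C -> B `<=` C -> pr mu B <= pr mu C.
Proof.
move=> mB mC BC; rewrite -lee_fin -!prE//.
by apply: le_measure => //; rewrite inE.
Qed.

Lemma prU B C : measurable B -> measurable C -> B `&` C = set0 ->
  pr mu (B `|` C) = pr mu B + pr mu C.
Proof.
move=> mB mC BC; apply/EFin_inj; rewrite EFinD -!prE//; first exact: measureU.
exact: measurableU.
Qed.

Lemma prU_le B C : measurable B -> measurable C ->
  pr mu (B `|` C) <= pr mu B + pr mu C.
Proof.
move=> mB mC; have mCB : measurable (C `\` B) by exact: measurableD.
have -> : B `|` C = B `|` (C `\` B) by apply/seteqP; split => x /=; case: (pselect (B x)); tauto.
rewrite prU//; last by apply/seteqP; split => x //= [? []].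
by rewrite lerD2l; apply: pr_le => //; exact: subDsetl.
Qed.

Lemma prID B C : measurable B -> measurable C ->
  pr mu B = pr mu (B `&` C) + pr mu (B `\` C).
Proof.
move=> mB mC; rewrite -prU ?setUIDK//; first exact: measurableI.
  exact: measurableD.
by apply/seteqP; split => x //= [[? ?] []].
Qed.

Lemma pr_sum (I : choiceType) (s : seq I) (P : pred I) (F : I -> set T) :
  uniq s -> (forall i, measurable (F i)) -> trivIset setT F ->
  pr mu (\big[setU/set0]_(i <- s | P i) F i) = \sum_(i <- s | P i) pr mu (F i).
Proof.
move=> + mF tF; elim: s => [|i s ih] /=; first by rewrite !big_nil pr_set0.
move=> /andP[si us]; rewrite !big_cons; case: ifP => Pi; last exact: ih.
rewrite prU ?ih//; first by apply: bigsetU_measurable.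
apply/seteqP; split => // x [Fx]; rewrite -bigcup_seq_cond => -[j /= /andP[js Pj] Fj].
move/trivIsetP: tF => /(_ i j Logic.I Logic.I) tF.
have ij : i != j by apply: contraNneq si => ->.
by have := tF ij => /seteqP[+ _] => /(_ x); apply.
Qed.

Lemma pr_sum_le (I : Type) (s : seq I) (P : pred I) (F : I -> set T) :
  (forall i, measurable (F i)) ->
  pr mu (\big[setU/set0]_(i <- s | P i) F i) <= \sum_(i <- s | P i) pr mu (F i).
Proof.
move=> mF; elim: s => [|i s ih] /=; first by rewrite !big_nil pr_set0.
rewrite !big_cons; case: ifP => Pi; last exact: ih.
by rewrite (le_trans (prU_le _ _))// ?lerD2l//; exact: bigsetU_measurable.
Qed.

Lemma pr_dist_triangle B C D : measurable B -> measurable C -> measurable D ->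
  pr mu (B `+` D) <= pr mu (B `+` C) + pr mu (C `+` D).
Proof.
move=> mB mC mD.
have mY X Y : measurable X -> measurable Y -> measurable (X `+` Y : set T).
  by move=> mX mY'; rewrite setY_def; apply: measurableU; exact: measurableD.
apply: le_trans (prU_le _ _); try exact: mY.
apply: pr_le; [exact: mY|by apply: measurableU; exact: mY|].
rewrite !setY_def => x /=; case: (pselect (C x)); tauto.
Qed.

Lemma measurableY B C : measurable B -> measurable C -> measurable (B `+` C).
Proof. by move=> mX mY'; rewrite setY_def; apply: measurableU; exact: measurableD. Qed.

Lemma pr_dist B C : measurable B -> measurable C ->
  `|pr mu B - pr mu C| <= pr mu (B `+` C).
Proof.
move=> mB mC.
have mBC : measurable (B `\` C) by exact: measurableD.
have mCB : measurable (C `\` B) by exact: measurableD.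
rewrite setY_def prU//; last by apply/seteqP; split => x //= [[? ?] [? ?]].
rewrite (prID mB mC) (prID mC mB) (setIC C B) opprD addrACA subrr add0r.
have := pr_ge0 (B `\` C); have := pr_ge0 (C `\` B).
by rewrite ler_norml; lra.
Qed.

Lemma pr_distC B C : pr mu (~` B `+` ~` C) = pr mu (B `+` C).
Proof.
congr pr; rewrite !setY_def; apply/seteqP; split => x /=.
  by move=> [[? /contrapT ?]|[? /contrapT ?]]; [right|left].
by move=> [[? ?]|[? ?]]; [right|left]; split => //; apply.
Qed.

Lemma pr_distU B B' C C' : measurable B -> measurable C ->
  measurable B' -> measurable C' ->
  pr mu ((B `|` C) `+` (B' `|` C')) <= pr mu (B `+` B') + pr mu (C `+` C').
Proof.
move=> mB mC mB' mC'; apply: le_trans (prU_le _ _); try exact: measurableY.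
apply: pr_le.
- by apply: measurableY; exact: measurableU.
- by apply: measurableU; exact: measurableY.
by rewrite !setY_def => x /=; tauto.
Qed.

Lemma pr_bigcup (F : nat -> set T) : (forall n, measurable (F n)) ->
  {homo F : n m / (n <= m)%N >-> n `<=` m} ->
  (fun n => pr mu (F n)) @ \oo --> pr mu (\bigcup_n F n).
Proof.
move=> mF ndF.
have mU : measurable (\bigcup_n F n) by exact: bigcup_measurable.
apply: fine_cvg; rewrite -prE//; apply: nondecreasing_cvg_mu => //.
by move=> n m nm; apply/subsetPset; exact: ndF.
Qed.

Lemma pr_bigcap (F : nat -> set T) : (forall n, measurable (F n)) ->
  {homo F : n m / (n <= m)%N >-> m `<=` n} ->
  (fun n => pr mu (F n)) @ \oo --> pr mu (\bigcap_n F n).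
Proof.
move=> mF ndF.
have mU : measurable (\bigcap_n F n) by exact: bigcap_measurable.
apply: fine_cvg; rewrite -prE//; apply: nonincreasing_cvg_mu => //.
  by rewrite ltey_eq; apply/orP; left; exact: fin_num_measure.
by move=> n m nm; apply/subsetPset; exact: ndF.
Qed.

(** Continuity from below in the pseudometric pr mu (B `+` C). *)
Lemma pr_bigcup_dist (F : nat -> set T) : (forall n, measurable (F n)) ->
  {homo F : n m / (n <= m)%N >-> n `<=` m} -> forall e, 0 < e ->
  \forall n \near \oo, pr mu ((\bigcup_n F n) `+` F n) < e.
Proof.
move=> mF ndF e e0.
have mU : measurable (\bigcup_n F n) by exact: bigcup_measurable.
have /cvgrPdist_lt /(_ e e0) := pr_bigcup mF ndF.
apply: filterS => n.
have mD : measurable (\bigcup_n F n `\` F n) by exact: measurableD.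
have -> : (\bigcup_n F n) `+` F n = (\bigcup_n F n) `\` F n.
  rewrite setY_def; apply/seteqP; split => x /=; last by left.
  by move=> [//|[Fx []]]; exists n.
rewrite (prID mU (mF n)).
have -> : \bigcup_n F n `&` F n = F n.
  by apply/seteqP; split => x //=; [case|move=> Fx; split => //; exists n].
by rewrite addrAC subrr add0r ger0_norm ?pr_ge0.
Qed.

End RealMeasure.

(** * Sets that depend on finitely many coordinates *)

Section LocalSets.
Context {A : alphabetType}.
Implicit Types (x y : full_shift A) (B : set (full_shift A)) (M : nat).

Definition agree M x y := forall i : int, `|i|%R <= M%:Z -> x i = y i.

Definition local M B := forall x y, agree M x y -> B x -> B y.

Lemma agreeC M x y : agree M x y -> agree M y x.
Proof. by move=> h i hi; rewrite h. Qed.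

Lemma localC M B : local M B -> local M (~` B).
Proof. by move=> lB x y xy nBx By; apply/nBx/lB/By/agreeC. Qed.

Lemma localU M B C : local M B -> local M C -> local M (B `|` C).
Proof. by move=> lB lC x y xy [/(lB _ _ xy)|/(lC _ _ xy)]; [left|right]. Qed.

Lemma local_le M M' B : (M <= M')%N -> local M B -> local M' B.
Proof. by move=> MM lB x y xy; apply: lB => i hi; apply: xy; lia. Qed.

Lemma near_agree M x : \forall y \near x, agree M x y.
Proof.
have F i : \forall y \near x, x i = y i.
  have pc := @proj_continuous int (fun=> discrete_topology A) i x.
  have h : nbhs (x i : discrete_topology A) [set x i] by exact: discrete_set1.
  have hx : nbhs x (proj i @^-1` [set x i]) by exact: (pc _ h).
  by apply: filterS hx => y yx; rewrite -yx.
have : \forall y \near x, forall k : 'I_(M + M).+1, x (k%:Z - M%:Z) = y (k%:Z - M%:Z).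
  apply: (@filter_forall _ _ (fun (k : 'I_(M + M).+1) (y : full_shift A) =>
    x (k%:Z - M%:Z) = y (k%:Z - M%:Z)) (nbhs x) _) => k; exact: F.
apply: filterS => y h i hi.
have kM : (absz (i + M%:Z)%R < (M + M).+1)%N by lia.
by have := h (Ordinal kM) => /=; have -> : (absz (i + M%:Z)%R)%:Z - M%:Z = i by lia.
Qed.

Lemma local_open M B : local M B -> open B.
Proof.
move=> lB; rewrite openE => x Bx.
by apply: filterS (near_agree M x) => y xy; exact: lB Bx.
Qed.

Lemma full_shift_open_measurable B : open B -> measurable B.
Proof. by move=> oB; apply: sub_sigma_algebra. Qed.

Lemma local_measurable M B : local M B -> measurable B.
Proof. by move=> /local_open; exact: full_shift_open_measurable. Qed.

(** The filter generated by the sets agree M x converges to x in every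
    coordinate, hence in the product topology, so it contains every
    neighbourhood of x. *)
Lemma nbhs_agree x B : nbhs x B -> exists M, agree M x `<=` B.
Proof.
pose F : set_system (prod_topology (fun _ : int => discrete_topology A)) := [set C | exists M, agree M x `<=` C].
have FF : Filter F.
  split; first by exists 0%N.
    move=> P Q [M1 h1] [M2 h2]; exists (maxn M1 M2) => y xy.
    by split; [apply: h1|apply: h2] => i hi; apply: xy; lia.
  by move=> P Q PQ [M1 h1]; exists M1; exact: subset_trans PQ.
have Fx : F --> (x : prod_topology (fun _ : int => discrete_topology A)).
  apply/cvg_sup => i.
  have FF' : @Filter (forall _ : int, discrete_topology A) F by [].
  have rT : range (fun f : (forall _ : int, discrete_topology A) => f i) = setT.
    by apply/seteqP; split => // a _; exists (fun=> a).
  have ci := (@cvg_image (forall _ : int, discrete_topology A) (discrete_topology A) (fun f => f i) F x FF' rT).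
  apply: (iffRL ci).
  move=> U xU /=.
  suff : exists2 C, F C & [set f i | f in C] = U by [].
  exists [set f : (forall _ : int, discrete_topology A) | U (f i)].
    exists (absz i) => y xy /=; rewrite -xy; last by lia.
    exact: nbhs_singleton xU.
  by apply/seteqP; split => [_ [y yU <-]//|a Ua]; exists (fun=> a).
by move=> /Fx.
Qed.

(** The largest set depending only on the coordinates in [-M, M] that is
    contained in B; for open B these sets increase to B. *)
Definition interior_at M B : set (full_shift A) := [set x | agree M x `<=` B].

Lemma interior_at_local M B : local M (interior_at M B).
Proof. by move=> x y xy h z yz; apply: h => i hi; rewrite xy ?yz. Qed.

Lemma interior_at_mono B : {homo interior_at^~ B : n m / (n <= m)%N >-> n `<=` m}.
Proof. by move=> n m nm x h y xy; apply: h => i hi; apply: xy; lia. Qed.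

Lemma open_bigcup_local B : open B -> B = \bigcup_M interior_at M B.
Proof.
move=> oB; apply/seteqP; split => [x Bx|x [M _]]; last by apply.
have [M h] := nbhs_agree (open_nbhs_nbhs (conj oB Bx)).
by exists M.
Qed.

Lemma compact_full_shift : compact [set: full_shift A].
Proof.
have cA (i : int) : compact [set: discrete_topology A].
  by apply: finite_compact; exact: (@finite_finset A).
have := @tychonoff int (fun=> discrete_topology A) (fun=> setT) cA.
by congr compact; apply/seteqP; split.
Qed.

(** Approximation is required for two measures at once: separating two ergodic
    measures by words needs a single local set close to a given set for both. *)
Section Approx.
Context {R : realType} (mu nu : {finite_measure set (full_shift A) -> \bar R}).

Definition approximable B := measurable B /\ forall e : R, 0 < e ->
  exists M P, [/\ local M P, pr mu (B `+` P) < e & pr nu (B `+` P) < e].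

Lemma local_approximable M B : local M B -> approximable B.
Proof.
move=> lB; split; first exact: local_measurable lB.
by move=> e e0; exists M, B; rewrite setYK !pr_set0.
Qed.

Lemma approximableC B : approximable B -> approximable (~` B).
Proof.
move=> [mB aB]; split; first exact: measurableC.
move=> e /aB [M [P [lP h1 h2]]]; exists M, (~` P); rewrite !pr_distC.
by split => //; exact: localC.
Qed.

Lemma approximableU B C : approximable B -> approximable C -> approximable (B `|` C).
Proof.
move=> [mB aB] [mC aC]; split; first exact: measurableU.
move=> e e0; have e2 : 0 < e / 2 by rewrite divr_gt0.
have [M [P [lP h1 h2]]] := aB _ e2.
have [M' [P' [lP' h1' h2']]] := aC _ e2.
exists (maxn M M'), (P `|` P').
have mP := local_measurable lP; have mP' := local_measurable lP'.
split.
- by apply: localU; [apply: local_le lP|apply: local_le lP']; lia.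
- by apply: (le_lt_trans (pr_distU _ _ _ _ _)) => //; lra.
- by apply: (le_lt_trans (pr_distU _ _ _ _ _)) => //; lra.
Qed.

Lemma approximable_nondecreasing (F : nat -> set (full_shift A)) :
  (forall n, approximable (F n)) ->
  {homo F : n m / (n <= m)%N >-> n `<=` m} -> approximable (\bigcup_n F n).
Proof.
move=> aF ndF; have mF n := (aF n).1.
have mU : measurable (\bigcup_n F n) by exact: bigcup_measurable.
split => // e e0; have e2 : 0 < e / 2 by rewrite divr_gt0.
have [n [h1 h2]] : exists n, pr mu ((\bigcup_n F n) `+` F n) < e / 2 /\
    pr nu ((\bigcup_n F n) `+` F n) < e / 2.
  near \oo => n; exists n; split; near: n; exact: pr_bigcup_dist.
have [M [P [lP h1' h2']]] := (aF n).2 _ e2.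
have mP := local_measurable lP.
by exists M, P; split => //; apply: le_lt_trans (pr_dist_triangle _ mU (mF n) mP) _; lra.
Unshelve. all: by end_near. Qed.

(** Approximable sets form a sigma-algebra, and an open set is an increasing
    union of local sets, so every Borel set is approximable. *)
Lemma measurable_approximable B : measurable B -> approximable B.
Proof.
apply: smallest_sub => [|O oO]; last first.
  rewrite (open_bigcup_local oO); apply: approximable_nondecreasing.
    by move=> n; apply: local_approximable; exact: interior_at_local.
  exact: interior_at_mono.
split.
- exact: (@local_approximable 0).
- by move=> C aC; rewrite setTD; exact: approximableC.
- move=> F aF; rewrite -bigcup_bigsetU_bigcup.
  have aU n : approximable (\big[setU/set0]_(i < n) F i).
    elim: n => [|n ih]; first by rewrite big_ord0; exact: (@local_approximable 0).
    by rewrite big_ord_recr; exact: approximableU.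
  apply: approximable_nondecreasing; first by move=> n; exact: aU.
  by move=> n m nm; exact: subset_bigsetU.
Qed.

Lemma local_same_measure :
  (forall M P, local M P -> mu P = nu P) -> forall B, measurable B -> mu B = nu B.
Proof.
move=> h B mB; rewrite !prE//; congr EFin.
apply/eqP; rewrite -subr_eq0 -normr_le0; apply/ler_addgt0Pr => e e0; rewrite add0r.
have e2 : 0 < e / 2 by rewrite divr_gt0.
have [_ /(_ _ e2) [M [P [lP h1 h2]]]] := measurable_approximable mB.
have mP := local_measurable lP.
have := pr_dist mu mB mP; have := pr_dist nu mB mP.
have -> : pr nu P = pr mu P by rewrite /pr (h _ _ lP).
rewrite !ler_norml; lra.
Qed.

End Approx.
End LocalSets.

(** * Extension of a finitely additive probability *)

(** A copy of the full shift whose measurable sets are the local sets; the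
    Caratheodory extension starts from this algebra. *)
Definition local_algebra (A : alphabetType) : Type := full_shift A.

Section LocalAlgebra.
Context {A : alphabetType}.
Implicit Types (B C : set (local_algebra A)).

Definition is_local B := exists M, local M B.

Lemma is_local0 : is_local set0.
Proof. by exists 0%N. Qed.

Lemma is_localU : setU_closed is_local.
Proof.
move=> B C [M lB] [M' lC]; exists (maxn M M').
by apply: localU; [apply: local_le lB|apply: local_le lC]; lia.
Qed.

Lemma is_localC : setC_closed is_local.
Proof. by move=> B [M lB]; exists M; exact: localC. Qed.

HB.instance Definition _ := Pointed.on (local_algebra A).
HB.instance Definition _ := isAlgebraOfSets.Build default_measure_display
  (local_algebra A) is_local0 is_localU is_localC.

(** A local set is closed, hence compact, and local sets are open. Therefore a
    countable union of local sets can only be local if it is a finite union. *)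
Lemma local_cover_finite (F : nat -> set (full_shift A)) :
  (forall n, is_local (F n)) -> is_local (\bigcup_n F n) ->
  exists N, \bigcup_n F n `<=` \bigcup_(n < N) F n.
Proof.
move=> lF [M lU].
have cU : compact (\bigcup_n F n : set (full_shift A)).
  apply: (subclosed_compact _ compact_full_shift) => //.
  by rewrite -openC; apply: local_open; exact: localC lU.
move: cU; rewrite compact_cover => /(_ nat setT F).
case; [by move=> n _; have [M' /local_open] := lF n|by []|].
move=> D _ hD; exists (\max_(i <- finmap.enum_fset D) i).+1 => x /hD [n nD Fnx]; exists n => //=.
by rewrite ltnS; apply: leq_bigmax_seq.
Qed.
End LocalAlgebra.

Section Extension.
Context {A : alphabetType} {R : realType} (m : set (full_shift A) -> R).
Hypothesis m_ge0 : forall B, 0 <= m B.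
Hypothesis mT : m setT = 1.
Hypothesis mU : forall B C, B `&` C = set0 -> m (B `|` C) = m B + m C.

Let m0 : m set0 = 0.
Proof. by have := mU (setI0 set0); rewrite setU0; lra. Qed.

Let mc (B : set (local_algebra A)) : \bar R := (m B)%:E.

Let mc0 : mc set0 = 0%E.
Proof. by rewrite /mc m0. Qed.

Let mc_ge0 B : (0 <= mc B)%E.
Proof. by rewrite lee_fin. Qed.

Let mc_sum (F : nat -> set (local_algebra A)) n : trivIset setT F ->
  (\sum_(0 <= i < n) mc (F i) = mc (\bigcup_(i < n) F i))%E.
Proof.
move=> tF; elim: n => [|n ih]; first by rewrite big_geq// bigcup_mkord big_ord0 mc0.
rewrite big_nat_recr//= ih !bigcup_mkord big_ord_recr/= /mc mU//.
rewrite -bigcup_mkord; apply/seteqP; split => // x [[i /= ilt Fi] Fn].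
move/trivIsetP: tF => /(_ i n Logic.I Logic.I); rewrite ltn_eqF// => /(_ isT).
by move=> /seteqP[+ _] => /(_ x); apply.
Qed.

Let mc_sigma : semi_sigma_additive mc.
Proof.
move=> F mF tF mU'; have [N hN] := local_cover_finite mF mU'.
apply: cvg_near_cst.
near=> n.
rewrite mc_sum//; congr mc; apply/seteqP; split => [x [i _ Fi]|x /hN [i /= iN Fi]].
  by exists i.
by exists i => //=; apply: (leq_trans iN); near: n; exact: nbhs_infty_ge.
Unshelve. all: by end_near. Qed.

HB.instance Definition _ := isMeasure.Build _ _ _ mc mc0 mc_ge0 mc_sigma.

Lemma sub_local_sigma (B : set (full_shift A)) : measurable B ->
  <<s @measurable _ (local_algebra A) >> B.
Proof.
apply: smallest_sub; first exact: smallest_sigma_algebra.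
have [_ _ scup] := smallest_sigma_algebra setT (@measurable _ (local_algebra A)).
move=> O /open_bigcup_local ->; apply: scup => n.
by apply: sub_sigma_algebra; exists n; exact: interior_at_local.
Qed.

Definition extension (B : set (full_shift A)) : \bar R := measure_extension mc B.

Lemma extensionE M B : local M B -> extension B = (m B)%:E.
Proof. by move=> lB; rewrite /extension /measure_extension measurable_mu_extE//; exists M. Qed.

Let ext0 : extension set0 = 0%E.
Proof. exact: measure0. Qed.

Let ext_ge0 B : (0 <= extension B)%E.
Proof. exact: measure_ge0. Qed.

Let ext_sigma : semi_sigma_additive extension.
Proof.
move=> F mF tF mUF.
exact: (@measure_semi_sigma_additive _ _ _ (measure_extension mc) F
  (fun i => sub_local_sigma (mF i)) tF (sub_local_sigma mUF)).
Qed.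

HB.instance Definition _ := isMeasure.Build _ _ _ extension ext0 ext_ge0 ext_sigma.

Let extT : extension setT = 1%E.
Proof. by rewrite (@extensionE 0) ?mT. Qed.

HB.instance Definition _ := Measure_isProbability.Build _ _ _ extension extT.

(** By [local_cover_finite] countable additivity on the algebra of local sets
    reduces to finite additivity, so m restricted to this algebra is a
    premeasure and extends to the Borel sets. *)
Lemma local_content_extends : exists mu : probability (full_shift A) R,
  forall M B, local M B -> pr mu B = m B.
Proof. by exists extension => M B lB; exact: (congr1 fine (extensionE lB)). Qed.

End Extension.

(** * Words read in a window, and their entropy *)

Section Windows.
Context {A : alphabetType}.
Implicit Types (x : full_shift A) (B : set (full_shift A)) (Q : set (seq A)) (w : seq A).

Definition window (a : int) n Q : set (full_shift A) := [set x | Q (subword x a n)].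

Lemma size_subword x a n : size (subword x a n) = n.
Proof. exact: size_mkseq. Qed.

Lemma subword_cat x a n m :
  subword x a (n + m) = subword x a n ++ subword x (a + n%:Z) m.
Proof.
rewrite /subword /mkseq iotaD map_cat add0n; congr cat.
rewrite -{1}(addn0 n) iotaDl -map_comp; apply: eq_map => j /=.
by congr x; lia.
Qed.

Lemma take_subword x a k n : (k <= n)%N -> take k (subword x a n) = subword x a k.
Proof.
by move=> kn; rewrite -(subnKC kn) subword_cat take_size_cat ?size_subword.
Qed.

Lemma drop_subword x a k n : (k <= n)%N ->
  drop k (subword x a n) = subword x (a + k%:Z) (n - k).
Proof.
by move=> kn; rewrite -{1}(subnKC kn) subword_cat drop_size_cat ?size_subword.
Qed.

Lemma subword_eq x y a n :
  subword x a n = subword y a n <-> (forall j : nat, (j < n)%N -> x (a + j%:Z) = y (a + j%:Z)).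
Proof.
split => [h j jn|h].
  have := congr1 (fun s => nth (x a) s j) h.
  by rewrite /subword !nth_mkseq.
by apply/eq_in_map => j; rewrite mem_iota add0n => /h.
Qed.

Lemma subword_left_shift x a n : subword (left_shift x) a n = subword x (a + 1) n.
Proof. by apply: eq_map => j; rewrite /left_shift; congr x; lia. Qed.

Lemma window_shift a n Q : left_shift @^-1` window a n Q = window (a + 1) n Q.
Proof. by apply/seteqP; split => x /=; rewrite /window /= subword_left_shift. Qed.

Lemma window_local a n Q : local (absz a + n) (window a n Q).
Proof.
move=> x y xy; rewrite /window /=.
suff -> : subword x a n = subword y a n by [].
by apply/subword_eq => j jn; apply: xy; lia.
Qed.

Lemma measurable_window a n Q : measurable (window a n Q).
Proof. exact: local_measurable (@window_local a n Q). Qed.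

(** Local sets are sets of words: this lets Borel approximation be restated as a
    condition on the word seen in a window. *)
Lemma local_window M B : local M B -> exists Q, B = window (- M%:Z) (M + M).+1 Q.
Proof.
move=> lB; exists [set subword x (- M%:Z) (M + M).+1 | x in B].
apply/seteqP; split => [x Bx|y [x Bx] /subword_eq xy]; first by exists x.
apply: lB Bx => i hi.
have := xy (absz (i + M%:Z)%R); have -> : - M%:Z + (absz (i + M%:Z)%R)%:Z = i by lia.
by apply; lia.
Qed.

Definition wcard n Q : nat := #|[pred w : n.-tuple A | `[< Q w >]]|.

Lemma sum_tuple_cat (V : nmodType) n m (F : seq A -> V) :
  \sum_(t : (n + m).-tuple A) F t =
  \sum_(u : n.-tuple A) \sum_(v : m.-tuple A) F (u ++ v).
Proof.
rewrite pair_bigA /=.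
rewrite (reindex (fun uv : n.-tuple A * m.-tuple A => cat_tuple uv.1 uv.2)) //=.
have s1 (t : (n + m).-tuple A) : size (take n t) == n.
  by rewrite size_takel// size_tuple leq_addr.
have s2 (t : (n + m).-tuple A) : size (drop n t) == m.
  by rewrite size_drop size_tuple addKn.
exists (fun t => (Tuple (s1 t), Tuple (s2 t))) => [[u v] _|t _] /=.
  congr pair; apply/val_inj => /=; first by rewrite take_size_cat ?size_tuple.
  by rewrite drop_size_cat ?size_tuple.
by apply/val_inj; rewrite /= cat_take_drop.
Qed.

End Windows.

Section Entropy.
Context {A : alphabetType} {R : realType}.
Implicit Types (mu : probability (full_shift A) R) (Q D : set (seq A)) (w : seq A).

Definition wprob mu w : R := pr mu (window 1 (size w) [set w]).

Definition entropy mu n : R := - \sum_(w : n.-tuple A) wprob mu w * ln (wprob mu w).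

Lemma pr_windows mu a n B : measurable B ->
  pr mu B = \sum_(w : n.-tuple A) pr mu (B `&` window a n [set tval w]).
Proof.
move=> mB; rewrite -pr_sum.
- congr pr; rewrite -bigcup_seq; apply/seteqP; split => [x Bx|x [w _ []]//].
  have s : size (subword x a n) == n by rewrite size_subword.
  by exists (Tuple s) => //=; rewrite mem_index_enum.
- exact: index_enum_uniq.
- by move=> w; apply: measurableI => //; exact: measurable_window.
- apply/trivIsetP => u v _ _ /eqP uv; apply/seteqP; split => // x [[_ xu] [_ xv]].
  by apply: uv; apply/val_inj; rewrite /= -xu -xv.
Qed.

Lemma pr_setT mu : pr mu setT = 1.
Proof. by rewrite /pr probability_setT. Qed.

Lemma pr_le1 mu B : measurable B -> pr mu B <= 1.
Proof. by move=> mB; rewrite -(pr_setT mu) pr_le. Qed.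

Lemma pr_setC mu B : measurable B -> pr mu (~` B) = 1 - pr mu B.
Proof.
move=> mB; rewrite -(pr_setT mu) -(setvU B) prU//; last by rewrite setICl.
  by rewrite addrK.
exact: measurableC.
Qed.

Lemma wprob_ge0 mu w : 0 <= wprob mu w.
Proof. exact: pr_ge0. Qed.

Lemma pr_window_sum mu a n Q : pr mu (window a n Q) =
  \sum_(w : n.-tuple A | `[< Q w >]) pr mu (window a n [set tval w]).
Proof.
rewrite (@pr_windows mu a n); last exact: measurable_window.
rewrite [RHS]big_mkcond; apply: eq_bigr => w _; case: asboolP => Qw.
  by congr pr; apply/seteqP; split => x /=; [case|move=> e; split => //; rewrite /window /= e].
rewrite (_ : _ `&` _ = set0) ?pr_set0//; apply/seteqP; split => // x [/= + e].
by rewrite /window /= e.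
Qed.

Lemma pr_word_window mu n Q : pr mu (window 1 n Q) =
  \sum_(w : n.-tuple A | `[< Q w >]) wprob mu w.
Proof.
by rewrite pr_window_sum; apply: eq_bigr => w _; rewrite /wprob size_tuple.
Qed.

Lemma sum_wprob mu n : \sum_(w : n.-tuple A) wprob mu w = 1.
Proof.
rewrite -(pr_setT mu) (@pr_windows mu 1 n setT)//.
by apply: eq_bigr => w _; rewrite setTI /wprob size_tuple.
Qed.

Section Invariant.
Variable mu : probability (full_shift A) R.
Hypothesis smu : shift_invariant mu.

Lemma pr_window_invariant a n Q : pr mu (window a n Q) = pr mu (window 1 n Q).
Proof.
have step b : pr mu (window (b + 1) n Q) = pr mu (window b n Q).
  by rewrite -window_shift /pr smu//; exact: measurable_window.
have steps b (k : nat) : pr mu (window (b + k%:Z) n Q) = pr mu (window b n Q).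
  elim: k => [|k ih]; first by rewrite addr0.
  by rewrite -ih -(step (b + k%:Z)); have -> : b + k.+1%:Z = b + k%:Z + 1 by lia.
have [a1|a1] := leP 1 a.
  by rewrite -(steps 1 (absz (a - 1)%R)); have -> : 1 + (absz (a - 1)%R)%:Z = a by lia.
by rewrite -(steps a (absz (1 - a)%R)); have -> : a + (absz (1 - a)%R)%:Z = 1 by lia.
Qed.

Lemma wprob_marginal_l n m (u : n.-tuple A) :
  \sum_(v : m.-tuple A) wprob mu (u ++ v) = wprob mu u.
Proof.
rewrite /wprob [RHS](@pr_windows mu (1 + n%:Z) m); last exact: measurable_window.
apply: eq_bigr => v _; congr pr; apply/seteqP; split => x; rewrite /window /=.
  rewrite size_cat !size_tuple subword_cat => e; have /eqP := e.
  by rewrite eqseq_cat ?size_subword ?size_tuple// => /andP[/eqP -> /eqP ->].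
by rewrite size_cat !size_tuple subword_cat => -[-> ->].
Qed.

Lemma wprob_marginal_r n m (v : m.-tuple A) :
  \sum_(u : n.-tuple A) wprob mu (u ++ v) = wprob mu v.
Proof.
rewrite /wprob -(pr_window_invariant (1 + n%:Z)).
rewrite [RHS](@pr_windows mu 1 n); last exact: measurable_window.
apply: eq_bigr => u _; congr pr; apply/seteqP; split => x; rewrite /window /=.
  rewrite size_cat !size_tuple subword_cat => e; have /eqP := e.
  by rewrite eqseq_cat ?size_subword ?size_tuple// => /andP[/eqP -> /eqP ->].
by rewrite size_cat !size_tuple subword_cat => -[-> ->].
Qed.

Lemma wprob_cat_eq0 n m (u : n.-tuple A) (v : m.-tuple A) :
  wprob mu u * wprob mu v = 0 -> wprob mu (u ++ v) = 0.
Proof.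
move=> /eqP; rewrite mulf_eq0 => /orP[/eqP h|/eqP h]; apply/eqP;
  rewrite eq_le wprob_ge0 andbT -h.
  rewrite -(wprob_marginal_l m u) (bigD1 v)//= lerDl.
  by apply: sumr_ge0 => *; exact: wprob_ge0.
rewrite -(wprob_marginal_r n v) (bigD1 u)//= lerDl.
by apply: sumr_ge0 => *; exact: wprob_ge0.
Qed.

(** Gibbs' inequality against the product of the two marginals; invariance makes
    the second marginal the distribution of words of length m. *)
Lemma entropy_subadditive n m : entropy mu (n + m) <= entropy mu n + entropy mu m.
Proof.
pose q (t : (n + m).-tuple A) := wprob mu (take n t) * wprob mu (drop n t).
apply: (@le_trans _ _ (- \sum_(t : (n + m).-tuple A) wprob mu t * ln (q t))).
  apply: gibbs.
  - by move=> t; exact: wprob_ge0.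
  - by move=> t; rewrite mulr_ge0// wprob_ge0.
  - move=> t; have s1 : size (take n t) == n by rewrite size_takel// size_tuple leq_addr.
    have s2 : size (drop n t) == m by rewrite size_drop size_tuple addKn.
    move=> h; have := @wprob_cat_eq0 n m (Tuple s1) (Tuple s2) h.
    by rewrite /= cat_take_drop.
  - rewrite sum_wprob /q (sum_tuple_cat n m (fun s => wprob mu (take n s) * wprob mu (drop n s))).
    under eq_bigr => u _ do under eq_bigr => v _
      do rewrite take_size_cat ?size_tuple// drop_size_cat ?size_tuple//.
    under eq_bigr => u _ do rewrite -mulr_sumr sum_wprob mulr1.
    by rewrite sum_wprob.
rewrite /q (sum_tuple_cat n m (fun s => wprob mu s * ln (wprob mu (take n s) * wprob mu (drop n s)))).
rewrite /entropy -opprD lerN2 le_eqVlt; apply/orP; left; apply/eqP.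
transitivity (\sum_(u : n.-tuple A) \sum_(v : m.-tuple A)
    (wprob mu (u ++ v) * ln (wprob mu u) + wprob mu (u ++ v) * ln (wprob mu v))).
  apply/esym; under eq_bigr => u _ do rewrite big_split/= -mulr_suml wprob_marginal_l.
  rewrite big_split/=; congr (_ + _).
  rewrite exchange_big /=; apply: eq_bigr => v _.
  by rewrite -mulr_suml wprob_marginal_r.
apply: eq_bigr => u _; apply: eq_bigr => v _.
rewrite take_size_cat ?size_tuple// drop_size_cat ?size_tuple//.
have [h|h] := eqVneq (wprob mu u * wprob mu v) 0.
  by rewrite (wprob_cat_eq0 h) !mul0r addr0.
have [h1 h2] : wprob mu u != 0 /\ wprob mu v != 0.
  by move: h; rewrite mulf_eq0 negb_or => /andP.
by rewrite -mulrDr lnM// posrE lt_neqAle eq_sym ?h1 ?h2 wprob_ge0.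
Qed.

End Invariant.

Lemma entropy_ge0 mu n : 0 <= entropy mu n.
Proof.
rewrite /entropy -sumrN; apply: sumr_ge0 => w _; rewrite -mulrN mulr_ge0 ?wprob_ge0//.
by rewrite oppr_ge0 ln_le0// pr_le1//; exact: measurable_window.
Qed.

End Entropy.

(** * Entropy and counting in a subshift with purely exponential growth *)

Section Language.
Context {A : alphabetType} {R : realType} (X : set (full_shift A)).
Hypothesis hX : subshift X.
Implicit Types (x : full_shift A) (w : seq A) (D : set (seq A)).

Definition translate (k : int) x : full_shift A := fun i => x (i + k).

Lemma subword_translate k x a n : subword (translate k x) a n = subword x (a + k) n.
Proof. by apply: eq_map => j; rewrite /translate; congr x; lia. Qed.

Lemma left_shiftE x : left_shift x = translate 1 x.
Proof. by []. Qed.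

Lemma translate_add k l x : translate k (translate l x) = translate (k + l) x.
Proof. by apply/funext => i; rewrite /translate; congr x; lia. Qed.

Lemma translate0 x : translate 0 x = x.
Proof. by apply/funext => i; rewrite /translate addr0. Qed.

Lemma subshift_left_shift x : X x <-> X (left_shift x).
Proof.
have [_ _ sX] := hX; split => [Xx|]; first by rewrite -sX; exists x.
rewrite -{1}sX => -[y Xy /(congr1 (translate (-1)))].
by rewrite !left_shiftE !translate_add addNr !translate0 => <-.
Qed.

Lemma subshift_translate k x : X x -> X (translate k x).
Proof.
have step (l : nat) y : X y -> X (translate l y).
  elim: l y => [|l ih] y Xy; first by rewrite translate0.
  have -> : translate l.+1 y = left_shift (translate l y).
    by rewrite left_shiftE translate_add; congr (translate _ y); lia.
  by rewrite -subshift_left_shift; exact: ih.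
have stepN (l : nat) y : X y -> X (translate (- l%:Z) y).
  elim: l y => [|l ih] y Xy; first by rewrite oppr0 translate0.
  apply/subshift_left_shift; rewrite left_shiftE translate_add.
  have -> : 1 - l.+1%:Z = - l%:Z by lia.
  exact: ih.
have [k0|k0] := leP 0 k.
  have -> : k = (absz k)%:Z by lia.
  exact: step.
have -> : k = - (absz k)%:Z by lia.
exact: stepN.
Qed.

Lemma languageP w : language X w <-> exists2 x, X x & subword x 1 (size w) = w.
Proof.
split => [[x [i [Xx xw]]]|[x Xx xw]]; last by exists x, 1.
exists (translate (i - 1) x); first exact: subshift_translate.
by rewrite subword_translate; have -> : 1 + (i - 1) = i by lia.
Qed.

Lemma language_subword x a n : X x -> language X (subword x a n).
Proof. by move=> Xx; exists x, a; rewrite size_subword. Qed.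

Lemma language_take k w : language X w -> language X (take k w).
Proof.
move=> /languageP[x Xx <-]; have [kw|kw] := leqP k (size w).
  by rewrite take_subword//; exact: language_subword.
by rewrite take_oversize ?size_subword 1?ltnW//; exact: language_subword.
Qed.

Lemma language_drop k w : language X w -> language X (drop k w).
Proof.
move=> /languageP[x Xx <-]; have [kw|kw] := leqP k (size w).
  by rewrite drop_subword//; exact: language_subword.
rewrite drop_oversize ?size_subword 1?ltnW//.
exact: (@language_subword x 1 0).
Qed.

Lemma language_extend w n : language X w -> (size w <= n)%N ->
  exists w' : n.-tuple A, language X w' /\ take (size w) w' = w.
Proof.
move=> /languageP[x Xx xw] wn.
have s : size (subword x 1 n) == n by rewrite size_subword.
by exists (Tuple s) => /=; rewrite take_subword//; split => //; exact: language_subword.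
Qed.

Lemma wcard_language_mul n m : (wcard (n + m) (language X) <=
  wcard n (language X) * wcard m (language X))%N.
Proof.
pose f (t : (n + m).-tuple A) := (insubd (nseq_tuple n point) (take n t),
   insubd (nseq_tuple m point) (drop n t)) : n.-tuple A * m.-tuple A.
have fE (t : (n + m).-tuple A) :
    (tval (f t).1 = take n t) * (tval (f t).2 = drop n t).
  split; rewrite /f /= val_insubd.
    by rewrite size_takel ?eqxx// size_tuple leq_addr.
  by rewrite size_drop size_tuple addKn eqxx.
have finj : injective f.
  move=> t u tu; apply/val_inj; rewrite /= -(cat_take_drop n t) -(cat_take_drop n u).
  by rewrite -!fE tu.
rewrite /wcard -(fintype.card_image finj) -cardX; apply/subset_leq_card/fintype.subsetP.
move=> _ /fintype.imageP[t + ->]; rewrite !inE /= !fE => /asboolP/asboolP Lt.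
by apply/andP; split; apply/asboolP; [exact: language_take|exact: language_drop].
Qed.

Lemma wcard_language_gt0 n : (0 < wcard n (language X))%N.
Proof.
have [[x Xx] _ _] := hX.
have s : size (subword x 1 n) == n by rewrite size_subword.
apply/card_gt0P; exists (Tuple s); rewrite inE; apply/asboolP/asboolP.
exact: language_subword.
Qed.

Lemma measurable_subshift : measurable X.
Proof.
rewrite -(setCK X); apply: measurableC; apply: full_shift_open_measurable.
by rewrite openC; have [] := hX.
Qed.

Lemma pr_setI_full (mu : probability (full_shift A) R) B :
  mu X = 1%E -> measurable B -> pr mu (B `&` X) = pr mu B.
Proof.
move=> muX mB; rewrite [RHS](prID mu mB measurable_subshift) -[LHS]addr0; congr (_ + _).
apply/esym/eqP; rewrite eq_le pr_ge0 andbT.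
have <- : pr mu (~` X) = 0.
  by rewrite pr_setC ?/pr ?muX ?subrr//; exact: measurable_subshift.
apply: pr_le => [||x []//]; last by apply: measurableC; exact: measurable_subshift.
by apply: measurableD => //; exact: measurable_subshift.
Qed.

Lemma pr_window_language (mu : probability (full_shift A) R) n D : mu X = 1%E ->
  pr mu (window 1 n (D `&` language X)) = pr mu (window 1 n D).
Proof.
move=> muX; rewrite -(pr_setI_full muX); last exact: measurable_window.
rewrite -[RHS](pr_setI_full muX); last exact: measurable_window.
congr pr; apply/seteqP; split => x [Dx Xx]; split => //; first by case: Dx.
by split => //; exact: language_subword.
Qed.

Let h := top_entropy R X.

(** Restriction to the first n and last m letters makes the number of words
    submultiplicative, so the topological entropy is an infimum. *)
Lemma ln_wcard_ge n : n%:R * h <= ln (wcard n (language X))%:R.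
Proof.
have [|m k|l cl] := @fekete R (fun n => ln (wcard n (language X))%:R).
- by move=> k; rewrite ln_ge0// ler1n wcard_language_gt0.
- rewrite -lnM ?posrE ?ltr0n ?wcard_language_gt0// -natrM.
  by rewrite ler_ln ?posrE ?ltr0n ?muln_gt0 ?wcard_language_gt0// ler_nat wcard_language_mul.
by have -> : h = l by exact: cvg_lim cl.
Qed.

Lemma wcard_ge n : expR (n%:R * h) <= (wcard n (language X))%:R.
Proof.
rewrite -[leRHS]lnK ?posrE ?ltr0n ?wcard_language_gt0// ler_expR.
exact: ln_wcard_ge.
Qed.

Section Growth.
Variable C : R.
Hypothesis hC : forall n, (wcard n (language X))%:R <= C * expR (n%:R * h).

Lemma growth_constant_ge1 : 1 <= C.
Proof.
have := hC 0; rewrite mul0r expR0 mulr1; apply: le_trans.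
by rewrite ler1n wcard_language_gt0.
Qed.

Lemma ln_wcard_le n : ln (wcard n (language X))%:R <= n%:R * h + ln C.
Proof.
have C0 : 0 < C := lt_le_trans ltr01 growth_constant_ge1.
rewrite -[n%:R * h]expRK addrC -lnM ?posrE ?expR_gt0//.
by rewrite ler_ln ?posrE ?ltr0n ?wcard_language_gt0// ?mulr_gt0 ?expR_gt0.
Qed.

Lemma top_entropy_ge0 : 0 <= h.
Proof.
rewrite leNgt; apply/negP => h0.
have := archi_boundP (divr_ge0 (_ : 0 <= ln C) (_ : 0 <= - h)).
set n := Num.Def.archi_bound _ => /(_ _ _).
have lC : 0 <= ln C by rewrite ln_ge0// growth_constant_ge1.
have mh : 0 <= - h by rewrite oppr_ge0 ltW.
move=> /(_ lC mh); rewrite ltr_pdivrMr ?oppr_gt0// => hn.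
have := ln_wcard_le n.
have : 0 <= ln (wcard n (language X))%:R :> R by rewrite ln_ge0// ler1n wcard_language_gt0.
lra.
Qed.

Implicit Types (mu : probability (full_shift A) R).

(** Gibbs' inequality against the weights that spread mass 1/2 uniformly over D
    and mass 1/2 uniformly over the language. *)
Lemma entropy_split mu n D : mu X = 1%E ->
  entropy mu n <= ln 2 + pr mu (window 1 n D) * ln (wcard n D)%:R +
    (1 - pr mu (window 1 n D)) * ln (wcard n (language X))%:R.
Proof.
move=> muX.
have mX := measurable_subshift.
have w0 (w : n.-tuple A) : ~ language X w -> wprob mu w = 0.
  move=> nLw; apply/eqP; rewrite eq_le wprob_ge0 andbT.
  have <- : pr mu (~` X) = 0 by rewrite pr_setC// /pr muX subrr.
  apply: pr_le; [exact: measurable_window|exact: measurableC|].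
  by move=> x /= e Xx; apply: nLw; apply/languageP; exists x.
pose q (w : n.-tuple A) : R := if `[< D w >] then (2 * (wcard n D)%:R)^-1 else
  if `[< language X w >] then (2 * (wcard n (language X))%:R)^-1 else 0.
have Lgt0 : (0 : R) < (wcard n (language X))%:R by rewrite ltr0n wcard_language_gt0.
have Dgt0 (w : n.-tuple A) : D w -> (0 : R) < (wcard n D)%:R.
  by move=> Dw; rewrite ltr0n; apply/card_gt0P; exists w; rewrite inE; exact/asboolP/asboolP.
apply: (@le_trans _ _ (- \sum_(w : n.-tuple A) wprob mu w * ln (q w))).
  apply: gibbs.
  - by move=> w; exact: wprob_ge0.
  - by move=> w; rewrite /q; case: ifP => _; [|case: ifP => _//];
      rewrite invr_ge0 mulr_ge0.
  - move=> w; rewrite /q; case: asboolP => Dw.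
      by move/eqP; rewrite invr_eq0 mulf_eq0 !gt_eqF// (Dgt0 w).
    case: asboolP => Lw; last by rewrite w0.
    by move/eqP; rewrite invr_eq0 mulf_eq0 !gt_eqF.
  - rewrite sum_wprob (bigID (fun w : n.-tuple A => `[< D w >]))/=.
    have half_le (k : nat) : (2 * k%:R)^-1 *+ k <= (2^-1 : R).
      case: k => [|k]; first by rewrite mulr0n invr_ge0.
      by rewrite -[leLHS]mulr_natr invfM -mulrA mulVf ?mulr1.
    have h1 : \sum_(w : n.-tuple A | `[< D w >]) q w <= 2^-1.
      rewrite (eq_bigr (fun=> (2 * (wcard n D)%:R)^-1)); last by rewrite /q => w ->.
      by rewrite sumr_const; exact: half_le.
    have h2 : \sum_(w : n.-tuple A | ~~ `[< D w >]) q w <= 2^-1.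
      apply: (@le_trans _ _ (\sum_(w : n.-tuple A | `[< language X w >])
          (2 * (wcard n (language X))%:R)^-1)); last by rewrite sumr_const; exact: half_le.
      rewrite big_mkcond [leRHS]big_mkcond/=; apply: ler_sum => w _; rewrite /q.
      by case: asboolP => Dw //=; case: ifP => // _; rewrite invr_ge0 mulr_ge0.
    by move: h1 h2; lra.
rewrite -sumrN.
apply: (@le_trans _ _ (\sum_(w : n.-tuple A) (wprob mu w * ln 2 +
    (if `[< D w >] then wprob mu w * ln (wcard n D)%:R
     else wprob mu w * ln (wcard n (language X))%:R)))).
  apply: ler_sum => w _; rewrite /q; case: asboolP => Dw.
    rewrite lnV ?posrE ?mulr_gt0 ?(Dgt0 w)// lnM ?posrE ?(Dgt0 w)//.
    by rewrite mulrN opprK mulrDr.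
  case: asboolP => Lw; last by rewrite w0// !mul0r oppr0 addr0.
  rewrite lnV ?posrE ?mulr_gt0// lnM ?posrE//.
  by rewrite mulrN opprK mulrDr.
rewrite big_split/= -mulr_suml sum_wprob mul1r -addrA lerD2l.
rewrite (bigID (fun w : n.-tuple A => `[< D w >]))/=; apply: lerD.
  rewrite (eq_bigr (fun w : n.-tuple A => wprob mu w * ln (wcard n D)%:R)); last by move=> w ->.
  by rewrite -mulr_suml (pr_word_window mu n D).
rewrite (eq_bigr (fun w : n.-tuple A => wprob mu w * ln (wcard n (language X))%:R)); last first.
  by move=> w /negbTE ->.
rewrite -mulr_suml ler_wpM2r ?ln_ge0 ?ler1n ?wcard_language_gt0//.
rewrite -(sum_wprob mu n) [X in _ <= X - _](bigID (fun w : n.-tuple A => `[< D w >]))/=.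
by rewrite (pr_word_window mu n D) addrAC subrr add0r.
Qed.

Lemma entropy_le mu n : mu X = 1%E -> entropy mu n <= n%:R * h + ln C + ln 2.
Proof.
move=> muX; have := entropy_split n set0 muX.
have -> : window 1 n set0 = set0 :> set (full_shift A) by [].
rewrite pr_set0 mul0r subr0 mul1r; have := ln_wcard_le n; lra.
Qed.

Lemma measure_entropyE mu : mu X = 1%E ->
  measure_entropy X mu = limn (fun n => n%:R^-1 * entropy mu n).
Proof.
move=> muX; rewrite /measure_entropy; congr (lim (_ @ \oo)).
apply/funext => n; rewrite -mulrN /entropy; congr (_ * - _).
have mX := measurable_subshift.
apply: eq_bigr => w _.
suff -> : fine (mu (cylinder X w)) = wprob mu w by [].
have -> : cylinder X w = window 1 (size w) [set tval w] `&` X.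
  by apply/seteqP; split => x [].
by rewrite [fine _](pr_setI_full muX)//; exact: measurable_window.
Qed.

(** The entropy of an invariant measure is the infimum of entropy mu n / n. *)
Lemma mme_entropy_ge mu n : max_entropy_measure X mu -> n%:R * h <= entropy mu n.
Proof.
move=> [smu muX]; rewrite measure_entropyE//.
have [||l cl le hl] := @fekete R (entropy mu).
- by move=> k; exact: entropy_ge0.
- by move=> k l; exact: entropy_subadditive.
by rewrite /h -hl (cvg_lim _ cl).
Qed.

(** The upper bound [entropy_le] holds with a bounded error term because of the
    growth hypothesis, so a lower bound with bounded error is enough. *)
Lemma entropy_ge_mme mu c : shift_invariant mu -> mu X = 1%E ->
  (forall n, n%:R * h - c <= entropy mu n) -> max_entropy_measure X mu.
Proof.
move=> smu muX hc; split => //; rewrite measure_entropyE//; apply: cvg_lim => //.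
have c1 (b : R) : (fun n => h + harmonic n * b) @ \oo --> h.
  have : (fun n => h + harmonic n * b) @ \oo --> h + 0 * b.
    apply: cvgD; first exact: cvg_cst.
    by apply: cvgM; [exact: cvg_harmonic|exact: cvg_cst].
  by rewrite mul0r addr0.
rewrite -cvg_shiftS.
apply: (squeeze_cvgr _ (c1 (- c)) (c1 (ln C + ln 2))).
apply: nearW => n; rewrite /harmonic /=.
have n0 : (0 : R) < n.+1%:R by rewrite ltr0n.
have hE b : h + n.+1%:R^-1 * b = n.+1%:R^-1 * (n.+1%:R * h + b).
  by rewrite mulrDr mulrA mulVf ?mul1r.
rewrite !hE !ler_pM2l ?invr_gt0// hc /= addrA; exact: entropy_le.
Qed.

(** The proportion of exp (n h) that the words of a set of measure at least e
    must reach; it depends on neither the measure nor the length. *)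
Definition density (e : R) : R := expR (- ((ln C + ln 2) / e)).

Lemma density_gt0 e : 0 < density e.
Proof. exact: expR_gt0. Qed.

(** If D had few words, the fraction of the mass carried by D would contribute
    too little to [entropy_split] for the entropy to reach n h, since the rest of
    the mass lives on at most C exp (n h) words. *)
Lemma mme_wcard_ge mu n D e : max_entropy_measure X mu -> 0 < e ->
  e <= pr mu (window 1 n D) -> density e * expR (n%:R * h) <= (wcard n D)%:R.
Proof.
move=> mmu e0; set p := pr mu _ => ep; have p0 : 0 < p := lt_le_trans e0 ep.
have muX : mu X = 1%E by case: mmu.
have Dgt0 : (0 : R) < (wcard n D)%:R.
  rewrite ltr0n lt0n; apply/eqP => D0; move: p0; rewrite /p pr_word_window big_pred0 ?ltxx//.
  by move=> w; have /card0_eq/(_ w) := D0; rewrite inE.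
rewrite -[leRHS]lnK ?posrE// /density -expRD ler_expR.
have := entropy_split n D muX; rewrite -/p.
have p1 : p <= 1 by apply: pr_le1; exact: measurable_window.
have := mme_entropy_ge n mmu; have lC := ln_wcard_le n.
have lnC0 : 0 <= ln C by rewrite ln_ge0// growth_constant_ge1.
have ln20 : 0 <= ln (2 : R) by rewrite ln_ge0// ler1n.
have : (1 - p) * ln (wcard n (language X))%:R <= (1 - p) * (n%:R * h + ln C).
  by rewrite ler_wpM2l// subr_ge0.
move=> h1 h2 h3.
have h4 : p * (n%:R * h) <= p * ln (wcard n D)%:R + (ln C + ln 2).
  have : 0 <= p * ln C by rewrite mulr_ge0// ltW.
  by move: h1 h2 h3; nra.
have h5 : (ln C + ln 2) / p <= (ln C + ln 2) / e.
  by rewrite ler_wpM2l ?addr_ge0// lef_pV2.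
have h6 : n%:R * h <= ln (wcard n D)%:R + (ln C + ln 2) / p.
  by rewrite -(ler_pM2l p0) mulrDr [p * (_ / p)]mulrCA divff ?gt_eqF// mulr1.
by move: h5 h6; lra.
Qed.

End Growth.
End Language.

(** * Separation of two ergodic measures *)

Section Separation.
Context {A : alphabetType} {R : realType}.
Implicit Types (B : set (full_shift A)).

Lemma measurable_left_shift B : measurable B -> measurable (left_shift @^-1` B).
Proof.
move: B; apply: smallest_sub; last first.
  move=> O /open_bigcup_local ->; rewrite preimage_bigcup.
  apply: bigcup_measurable => n _; apply: (@local_measurable _ n.+1) => x y xy.
  by apply: interior_at_local => i hi; apply: xy; lia.
split => [|B mB|F mF]; first by rewrite /mkset preimage_set0.
  by rewrite /mkset setTD preimage_setC; exact: measurableC.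
by rewrite /mkset preimage_bigcup; exact: bigcup_measurable.
Qed.

Section Maximizers.
Variables (mu nu : probability (full_shift A) R).
Hypotheses (smu : shift_invariant mu) (snu : shift_invariant nu).

Let D B := pr mu B - pr nu B.

Definition maximizer B := measurable B /\
  forall E, measurable E -> pr mu E - pr nu E <= pr mu B - pr nu B.

(** The positive set of a Hahn decomposition of mu - nu. *)
Lemma hahn_maximizer : exists P, maximizer P.
Proof.
pose c := cadd (charge_of_finite_measure mu) (cscale (-1) (charge_of_finite_measure nu)).
have cE B : measurable B -> c B = (D B)%:E.
  move=> mB; transitivity (mu B + (-1)%:E * nu B)%E => //.
  by rewrite (prE mu mB) (prE nu mB) -EFinM mulN1r -EFinD.
have [P [N [[mP posP] [mN negN] PN PN0]]] := Hahn_decomposition c.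
exists P; split => // E mE.
have mEP : measurable (E `&` P) by exact: measurableI.
have mED : measurable (E `\` P) by exact: measurableD.
have mPE : measurable (P `\` E) by exact: measurableD.
have h1 : D (E `\` P) <= 0.
  rewrite -lee_fin -cE//; apply: negN => //.
  move=> x [_ nPx]; have : [set: full_shift A] x by [].
  by rewrite -PN => -[].
have h2 : 0 <= D (P `\` E).
  by rewrite -lee_fin -cE//; apply: posP => //; exact: subDsetl.
rewrite (prID mu mE mP) (prID nu mE mP) (prID mu mP mE) (prID nu mP mE) (setIC P E).
by move: h1 h2; rewrite /D; lra.
Qed.

Lemma maximizer_shift B : maximizer B -> maximizer (left_shift @^-1` B).
Proof.
move=> [mB hB]; split; first exact: measurable_left_shift.
by move=> E mE; rewrite /pr smu// snu//; exact: hB.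
Qed.

Lemma maximizerU B C : maximizer B -> maximizer C -> maximizer (B `|` C).
Proof.
move=> [mB hB] [mC hC]; have mU := measurableU _ _ mB mC; have mI := measurableI _ _ mB mC.
split => // E mE; apply: (le_trans (hB _ mE)).
have := hC _ mI.
have mCB : measurable (C `\` B) by exact: measurableD.
have -> : B `|` C = B `|` (C `\` B) by apply/seteqP; split => x /=; case: (pselect (B x)); tauto.
have d0 : B `&` (C `\` B) = set0 by apply/seteqP; split => x //= [? []].
rewrite !prU// (prID mu mC mB) (prID nu mC mB) (setIC C B); lra.
Qed.

Lemma maximizer_bigcup (F : nat -> set (full_shift A)) : (forall n, maximizer (F n)) ->
  {homo F : n m / (n <= m)%N >-> n `<=` m} -> maximizer (\bigcup_n F n).
Proof.
move=> hF ndF; have mF n := (hF n).1; split; first exact: bigcup_measurable.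
move=> E mE.
have c1 : (fun n => pr mu (F n) - pr nu (F n)) @ \oo -->
    pr mu (\bigcup_n F n) - pr nu (\bigcup_n F n) by apply: cvgB; exact: pr_bigcup.
have <- := cvg_lim _ c1; last by [].
apply: limr_ge; first by apply/cvg_ex; eexists; exact: c1.
by apply: nearW => n; exact: (hF n).2.
Qed.

Lemma maximizer_bigcap (F : nat -> set (full_shift A)) : (forall n, maximizer (F n)) ->
  {homo F : n m / (n <= m)%N >-> m `<=` n} -> maximizer (\bigcap_n F n).
Proof.
move=> hF ndF; have mF n := (hF n).1; split; first exact: bigcap_measurable.
move=> E mE.
have c1 : (fun n => pr mu (F n) - pr nu (F n)) @ \oo -->
    pr mu (\bigcap_n F n) - pr nu (\bigcap_n F n) by apply: cvgB; exact: pr_bigcap.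
have <- := cvg_lim _ c1; last by [].
apply: limr_ge; first by apply/cvg_ex; eexists; exact: c1.
by apply: nearW => n; exact: (hF n).2.
Qed.

(** Maximizers are stable under the shift, finite unions, increasing unions and
    decreasing intersections. Hence the set of points whose orbit enters a given
    maximizer P infinitely often is again a maximizer, and it is invariant. *)
Lemma invariant_maximizer :
  exists B, maximizer B /\ left_shift @^-1` B = B.
Proof.
have [P hP] := hahn_maximizer.
pose Pk k := iter k (preimage left_shift) P.
have hPk k : maximizer (Pk k) by elim: k => [//|k ih]; exact: maximizer_shift.
pose U n := \bigcup_k Pk (n + k)%N.
have hU n : maximizer (U n).
  rewrite /U -bigcup_bigsetU_bigcup; apply: maximizer_bigcup.
    elim => [|k ih]; first by rewrite big_ord_recr/= big_ord0 set0U.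
    by rewrite big_ord_recr; exact: maximizerU.
  by move=> k m km; exact: (@subset_bigsetU _ (fun k => Pk (n + k)%N) k.+1 m.+1 km).
have ndU : {homo U : n m / (n <= m)%N >-> m `<=` n}.
  move=> n m nm x [k _ kx]; exists (m - n + k)%N => //.
  by have -> : (n + (m - n + k) = m + k)%N by lia.
exists (\bigcap_n U n); split; first exact: maximizer_bigcap.
have sU n : left_shift @^-1` U n = U n.+1.
  by rewrite /U preimage_bigcup; apply: eq_bigcupr => k _; rewrite addSn.
rewrite preimage_bigcap; apply/seteqP; split => x h n _.
  by apply: (ndU n n.+1) => //; rewrite -sU; exact: h.
by rewrite sU; exact: h.
Qed.

End Maximizers.

(** On an invariant maximizer of mu - nu the difference is positive, and by
    ergodicity each measure is 0 or 1 there. *)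
Lemma ergodic_separation (mu nu : probability (full_shift A) R) :
  ergodic mu -> ergodic nu -> ~ same_measure mu nu ->
  exists B, [/\ measurable B, pr mu B = 1 & pr nu B = 0].
Proof.
move=> [smu emu] [snu enu] neq.
have [B [[mB hB] iB]] := invariant_maximizer smu snu.
exists B.
have pos : 0 < pr mu B - pr nu B.
  rewrite ltNge; apply/negP => le0; apply: neq => E mE; rewrite !prE//; congr EFin.
  have := hB _ mE; have := hB _ (measurableC mE); rewrite !pr_setC//.
  lra.
move: pos; rewrite /pr.
case: (emu _ mB iB) => ->; case: (enu _ mB iB) => -> //=; rewrite ?subrr ?ltxx// sub0r.
by rewrite oppr_gt0 ltr10.
Qed.

End Separation.

(** * Gluing typical words of two ergodic measures *)

Section WordCounting.
Context {A : alphabetType}.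
Implicit Types (D E V W : set (seq A)).

Definition wset n D : {set n.-tuple A} := [set w | `[< D (tval w) >]]%SET.

Lemma wcardE n D : wcard n D = #|wset n D|.
Proof. by rewrite /wset cardsE. Qed.

Lemma in_wset n D (w : n.-tuple A) : (w \in wset n D) <-> D w.
Proof. by rewrite /wset finset.in_set; split => /asboolP. Qed.

Lemma wcardD n D E : D `<=` E -> (wcard n (E `\` D) + wcard n D = wcard n E)%N.
Proof.
move=> DE; rewrite !wcardE -(cardsID (wset n D) (wset n E)) addnC; congr (_ + _)%N.
  apply/eq_card => w; apply/idP/idP.
    by move=> /in_wset Dw; rewrite finset.in_setI; apply/andP; split; apply/in_wset => //; exact: DE.
  by rewrite finset.in_setI => /andP[].
apply/eq_card => w; apply/idP/idP.
  move=> /in_wset[Ew nDw]; rewrite finset.in_setD; apply/andP; split; last exact/in_wset.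
  by apply/negP => /in_wset.
by rewrite finset.in_setD => /andP[/negP nD /in_wset Ew]; apply/in_wset; split => // /in_wset.
Qed.

Lemma wcard_sum_le n K (E : nat -> set (seq A)) L :
  (forall i, (i < K)%N -> E i `<=` L) ->
  (forall i j, (i < j < K)%N -> E i `&` E j = set0) ->
  (\sum_(i < K) wcard n (E i) <= wcard n L)%N.
Proof.
elim: K L => [|K ih] L EL dE; first by rewrite big_ord0.
rewrite big_ord_recr/= -(@wcardD n (E K) L); last exact: EL.
rewrite leq_add2r; apply: ih => [i iK x Ex|i j ijK]; last by apply: dE; lia.
split; first by apply: EL Ex; lia.
move=> EKx; have /seteqP[/(_ x) + _] := dE i K ltac:(lia).
by apply.
Qed.

(** The hypothesis says that reading off the two blocks maps the words of E onto
    the pairs in V x W. *)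
Lemma wcard_mul_le n k g m V W E : (k + g + m <= n)%N ->
  (forall v w, V v -> size v = k -> W w -> size w = m ->
    exists u : n.-tuple A, [/\ E u, take k u = v & take m (drop (k + g) u) = w]) ->
  (wcard k V * wcard m W <= wcard n E)%N.
Proof.
move=> kgm hE.
have s1 (t : n.-tuple A) : size (take k t) == k.
  by rewrite size_takel// size_tuple; lia.
have s2 (t : n.-tuple A) : size (take m (drop (k + g) t)) == m.
  by rewrite size_takel// size_drop size_tuple; lia.
pose f (t : n.-tuple A) : k.-tuple A * m.-tuple A := (Tuple (s1 t), Tuple (s2 t)).
rewrite !wcardE -cardsX; apply: leq_trans (leq_imset_card f (wset n E)).
apply/subset_leq_card/fintype.subsetP => -[v w]; rewrite finset.in_setX /= => /andP[/in_wset Vv /in_wset Ww].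
have [u [Eu uv uw]] := hE v w Vv (size_tuple v) Ww (size_tuple w).
by apply/imsetP; exists u; [exact/in_wset|congr pair; apply/val_inj].
Qed.

End WordCounting.

Definition charges_words {A : alphabetType} {R : realType} (G : set (seq A))
    (mu : probability (full_shift A) R) (e : R) (S : set nat) :=
  forall n, S n -> e < pr mu (window 1 n G).

Section TwoErgodic.
Context {A : alphabetType} {R : realType} (X : set (full_shift A)).
Hypothesis hX : subshift X.
Variable C : R.
Hypothesis hC : forall n,
  (wcard n (language X))%:R <= C * expR (n%:R * top_entropy R X).
Variables (G : set (seq A)) (gap : nat).
Hypothesis hgap : forall v w : seq A, G v -> G w ->
    exists y : gap.-tuple A, language X (v ++ y ++ w).
Implicit Types (mu nu : probability (full_shift A) R) (Q : set (seq A)).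

(** A set of measure 1 for mu and 0 for nu is approximated for both measures by
    a condition on one window, which invariance moves to the origin. *)
Lemma separating_words mu nu (e : R) : ergodic mu -> ergodic nu ->
  ~ same_measure mu nu -> 0 < e -> exists l Q,
    pr mu (window 1 l (~` Q)) < e /\ pr nu (window 1 l Q) < e.
Proof.
move=> emu enu neq e0.
have [B [mB muB nuB]] := ergodic_separation emu enu neq.
have [_ /(_ e e0) [M [P [lP h1 h2]]]] := measurable_approximable mu nu mB.
have mP := local_measurable lP.
have [Q PQ] := local_window lP.
exists (M + M).+1, Q; split.
  have -> : window 1 (M + M).+1 (~` Q) = ~` window 1 (M + M).+1 Q by [].
  have mW := measurable_window 1 (M + M).+1 Q.
  rewrite pr_setC// -(pr_window_invariant emu.1 (- M%:Z)) -PQ.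
  by have := pr_dist mu mB mP; rewrite muB ler_norml; lra.
rewrite -(pr_window_invariant enu.1 (- M%:Z)) -PQ.
by have := pr_dist nu mB mP; rewrite nuB ler_norml; lra.
Qed.

Lemma ending_words_large mu (e d : R) k l Q : shift_invariant mu -> (l <= k)%N ->
  e < pr mu (window 1 k G) -> pr mu (window 1 l (~` Q)) < d ->
  e - d <= pr mu (window 1 k (G `&` [set v | Q (drop (k - l) v)])).
Proof.
move=> smu lk hG hQ.
have mW a n D := @measurable_window A a n D.
have sub : window 1 k G `<=` window 1 k (G `&` [set v | Q (drop (k - l) v)]) `|`
    window (1 + (k - l)%:Z) l (~` Q).
  move=> x Gx; case: (pselect (Q (subword x (1 + (k - l)%:Z) l))) => Qx; [left|by right].
  split => //=; rewrite drop_subword; last by lia.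
  by have -> : (k - (k - l) = l)%N by lia.
have h1 := pr_le mu (mW _ _ _) (measurableU _ _ (mW _ _ _) (mW _ _ _)) sub.
have := le_trans h1 (prU_le _ (mW _ _ _) (mW _ _ _)).
by rewrite (pr_window_invariant smu (1 + _)); lra.
Qed.

Lemma avoiding_words_large nu (e d : R) m l Q K (p : nat -> nat) (J : pred nat) :
  shift_invariant nu -> (forall j, (j < K)%N -> J j -> (p j + l <= m)%N) ->
  e < pr nu (window 1 m G) -> pr nu (window 1 l Q) < d ->
  e - K%:R * d <= pr nu (window 1 m
    (G `&` [set w | forall j, (j < K)%N -> J j -> ~ Q (take l (drop (p j) w))])).
Proof.
move=> snu pm hG hQ.
have mW a n D := @measurable_window A a n D.
set W := _ `&` _.
have sub : window 1 m G `<=` window 1 m W `|`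
    \big[setU/set0]_(j < K | J j) window (1 + (p j)%:Z) l Q.
  move=> x Gx; case: (pselect (exists2 j : 'I_K, J j & Q (subword x (1 + (p j)%:Z) l))).
    by move=> [j Jj Qx]; right; rewrite -bigcup_seq_cond; exists j => //=; rewrite mem_index_enum.
  move=> nQ; left; split => // j jK Jj Qx; apply: nQ; exists (Ordinal jK) => //=.
  move: Qx => /=; rewrite drop_subword ?take_subword//; have := pm _ jK Jj; lia.
have mU : measurable (\big[setU/set0]_(j < K | J j) window (1 + (p j)%:Z) l Q).
  by apply: bigsetU_measurable.
have h1 := pr_le nu (mW _ _ _) (measurableU _ _ (mW _ _ _) mU) sub.
have h2 := le_trans h1 (prU_le _ (mW _ _ _) mU).
have h3 := pr_sum_le nu (index_enum _) (fun j : 'I_K => J j) (fun j : 'I_K => mW (1 + (p j)%:Z) l Q).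
have h4 : \sum_(j < K | J j) pr nu (window (1 + (p j)%:Z) l Q) <= K%:R * d.
  apply: (@le_trans _ _ (\sum_(j < K) d)); last by rewrite sumr_const card_ord mulr_natl.
  rewrite big_mkcond/=; apply: ler_sum => j _; rewrite (pr_window_invariant snu).
  by case: ifP => _; [exact: ltW|apply: ltW; apply: le_lt_trans hQ; exact: pr_ge0].
move: h2 h3 h4; lra.
Qed.

Lemma drop_take_window (T : Type) (u : seq T) l k : (l <= k)%N ->
  drop (k - l) (take k u) = take l (drop (k - l) u).
Proof. by move=> lk; rewrite take_drop subnKC. Qed.

Lemma take_drop_take (T : Type) (u : seq T) l p m : (p + l <= m)%N ->
  take l (drop p (take m u)) = take l (drop p u).
Proof.
move=> plm; have e : ((m - p) + p = m)%N by lia.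
by rewrite -{1}e -take_drop take_takel//; lia.
Qed.

(** Suppose mu and nu differ, and let Q be a set of words of length l that is
    typical for mu and rare for nu. Choose positions k 0, ..., k (K - 1), far
    apart, and let E i consist of the words of length n of the form v y w with v
    of length k i in G ending in Q, and w in G avoiding Q in the windows that end
    at the later positions k j. A word of E i does not see Q just before k j
    while a word of E j does, so the E i are disjoint. The gluing hypothesis and
    [mme_wcard_ge], applied to v and to w, give E i at least b exp (n h) words,
    where b > 0 does not depend on K. For K > C / b the language has too many
    words. *)
Lemma ergodic_mme_same mu nu (e : R) (S1 S2 : set nat) :
  ergodic mu -> max_entropy_measure X mu -> ergodic nu -> max_entropy_measure X nu ->
  0 < e -> syndetic S1 -> charges_words G mu e S1 -> syndetic S2 -> charges_words G nu e S2 ->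
  same_measure mu nu.
Proof.
move=> emu mmu enu mnu e0 [N1 syn1] ch1 [N2 syn2] ch2; apply: contrapT => neq.
have e2 : 0 < e / 2 by rewrite divr_gt0.
pose h := top_entropy R X; have h0 : 0 <= h := top_entropy_ge0 hX hC.
pose c := density C (e / 2); have c0 : 0 < c := density_gt0 C (e / 2).
pose b := c * c * expR (- ((gap + N2)%:R * h)).
have b0 : 0 < b by rewrite !mulr_gt0// expR_gt0.
have C0 : 0 <= C := le_trans ler01 (growth_constant_ge1 hX hC).
have := archi_boundP (divr_ge0 C0 (ltW b0)); set K := Num.Def.archi_bound _ => CK.
(* Small enough for K exceptional sets of measure d to cost at most e / 2. *)
pose d := e / (2 * K.+1%:R).
have d0 : 0 < d by rewrite divr_gt0// mulr_gt0// ltr0n.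
have dK : d * K.+1%:R = e / 2.
  by rewrite /d invfM mulrA -mulrA mulVf ?mulr1.
have dE : K%:R * d <= e / 2 /\ d <= e / 2.
  by move: dK d0; rewrite -natr1; have : (0 : R) <= K%:R by []; split; nra.
have [l [Q [hQ1 hQ2]]] := separating_words emu enu neq d0.
(* T is abstracted so that the arithmetic on positions stays linear. *)
have [T TE] : exists T, T = (N1 + gap + l)%N by exists (N1 + gap + l)%N.
have mulT i j : (i < j)%N -> (T + i * T <= j * T)%N.
  by move=> ij; rewrite -mulSn leq_mul2r ij orbT.
have /choice[k hk] : forall i, exists k, [/\ (l + i * T <= k)%N, (k < l + i * T + N1)%N & S1 k].
  by move=> i; have [k /andP[k1 k2] Sk] := syn1 (l + i * T)%N; exists k.
have [n nE] : exists n, n = (l + K * T + gap + N2)%N by eexists.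
have kT i j : (i < j)%N -> (k i + gap + l <= k j)%N.
  by move=> /mulT ij; have [_ k1 _] := hk i; have [k2 _ _] := hk j;
     clear -ij k1 k2 TE; lia.
have kK i : (i < K)%N -> (k i + gap + N2 <= n)%N.
  by move=> /mulT iK; have [_ k1 _] := hk i; clear -iK k1 TE nE; lia.
(* The length of w is taken in S2; the at most N2 missing letters are added
   later by extending the glued word to the right. *)
have /choice[m hm] : forall i, exists m, (i < K)%N ->
    [/\ (n <= k i + gap + m + N2)%N, (k i + gap + m <= n)%N & S2 m].
  move=> i; have [iK|iK] := ltnP i K; last by exists 0%N.
  have [m /andP[m1 m2] Sm] := syn2 (n - (k i + gap + N2))%N.
  have kn := kK _ iK; exists m => _; split => //; clear -m1 m2 kn; lia.
(* The place in w of the window of length l that ends at k j in v y w. *)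
pose p i j := (k j - l - (k i + gap))%N.
pose V i := G `&` [set v | Q (drop (k i - l) v)].
pose W i := G `&` [set w | forall j, (j < K)%N -> (i < j)%N -> ~ Q (take l (drop (p i j) w))].
have pm i j : (i < K)%N -> (j < K)%N -> (i < j)%N -> (p i j + l <= m i)%N.
  move=> iK jK ij; have [m1 m2 _] := hm _ iK; have k1 := kT _ _ ij; have k3 := kK _ jK.
  have [k2 _ _] := hk j; rewrite /p; clear -m1 m2 k1 k2 k3; lia.
have lk i : (l <= k i)%N by have [k2 _ _] := hk i; clear -k2; lia.
pose E i := [set u | [/\ size u = n, language X u, V i (take (k i) u) &
   W i (take (m i) (drop (k i + gap) u))]].
have EV i : (i < K)%N -> b * expR (n%:R * h) <= (wcard n (E i))%:R.
  move=> iK; have [m1 m2 Sm] := hm _ iK.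
  have [_ _ Sk] := hk i.
  have hV : e / 2 <= pr mu (window 1 (k i) (V i)).
    apply: (le_trans _ (ending_words_large emu.1 (lk i) (ch1 _ Sk) hQ1)).
    by have := dE.2; lra.
  have hW : e / 2 <= pr nu (window 1 (m i) (W i)).
    apply: (le_trans _ (avoiding_words_large enu.1
      (fun j jK ij => pm i j iK jK ij) (ch2 _ Sm) hQ2)).
    by have := dE.1; lra.
  have cV := mme_wcard_ge hX hC mmu e2 hV.
  have cW := mme_wcard_ge hX hC mnu e2 hW.
  apply: (@le_trans _ _ ((wcard (k i) (V i) * wcard (m i) (W i))%N%:R)).
    rewrite natrM; apply: le_trans (ler_pM _ _ cV cW); last 2 first.
    - by rewrite mulr_ge0// ?expR_ge0// ltW.
    - by rewrite mulr_ge0// ?expR_ge0// ltW.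
    rewrite -/h -/c mulrACA /b -mulrA; apply: ler_wpM2l; first by rewrite mulr_ge0// ltW.
    rewrite -!expRD ler_expR -!mulrDl -mulNr -mulrDl ler_wpM2r//.
    rewrite -natrD addrC lerBlDr -natrD ler_nat; clear -m1 m2; lia.
  rewrite ler_nat; apply: (@wcard_mul_le _ _ _ gap) => // v w Vv sv Ww sw.
  have [y Ly] := hgap Vv.1 Ww.1.
  have sz : size (v ++ y ++ w) = (k i + gap + m i)%N.
    by rewrite !size_cat size_tuple sv sw addnA.
  have [|u [Lu uE]] := @language_extend _ X hX _ n Ly; first by rewrite sz.
  have tu : take (k i) u = v.
    by rewrite -(take_size_cat (y ++ w) sv) -uE take_takel// sz; clear; lia.
  have du : take (m i) (drop (k i + gap) u) = w.
    rewrite take_drop; have -> : (m i + (k i + gap) = size (v ++ y ++ w))%N.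
      by rewrite sz; clear; lia.
    by rewrite uE catA drop_size_cat// size_cat size_tuple sv.
  by exists u; split => //; rewrite /E /= tu du size_tuple.
have dis i j : (i < j < K)%N -> E i `&` E j = set0.
  move=> /andP[ij jK]; have iK := ltn_trans ij jK.
  apply/seteqP; split => // u [[_ _ _ [_ Wi]] [_ _ [_ Vj] _]].
  apply: (Wi j jK ij); rewrite take_drop_take ?pm// drop_drop.
  move: Vj => /=; rewrite drop_take_window//.
  have -> // : (p i j + (k i + gap) = k j - l)%N.
  by rewrite /p; have k1 := kT _ _ ij; clear -k1; lia.
have total : (\sum_(i < K) wcard n (E i) <= wcard n (language X))%N.
  by apply: wcard_sum_le => // i _ u [].
have := hC n; rewrite leNgt => /negP; apply.
apply: (@lt_le_trans _ _ (K%:R * b * expR (n%:R * h))).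
  by rewrite ltr_pM2r ?expR_gt0// -ltr_pdivrMr.
apply: (@le_trans _ _ (\sum_(i < K) wcard n (E i))%N%:R); last by rewrite ler_nat.
rewrite natr_sum -mulrA mulr_natl -[X in _ *+ X]card_ord -sumr_const.
by apply: ler_sum => i _; exact: EV.
Qed.

End TwoErgodic.

(** * Every measure of maximal entropy is ergodic *)

Section Conditioning.
Context {A : alphabetType} {R : realType}.
Implicit Types (mu : probability (full_shift A) R) (B E : set (full_shift A)).

Definition conditional mu B (mB : measurable B) : probability (full_shift A) R :=
  mnormalize (mrestr mu mB) mu.

Lemma conditionalE mu B (mB : measurable B) E : 0 < pr mu B -> measurable E ->
  pr (conditional mu mB) E = pr mu (E `&` B) / pr mu B.
Proof.
move=> B0 mE; have mEB : measurable (E `&` B) by exact: measurableI.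
have bE : mrestr mu mB setT = (pr mu B)%:E by rewrite /mrestr setTI; exact: prE.
have -> : pr (conditional mu mB) E = fine (mnormalize (mrestr mu mB) mu E) by [].
have bN : (mrestr mu mB setT == 0%E) || (mrestr mu mB setT == +oo%E) = false.
  by rewrite bE eqe (gt_eqF B0).
rewrite /mnormalize /=; case: ifPn => [bad|_].
  have : false by rewrite -bN; exact: bad.
  by [].
transitivity (fine (mu (E `&` B) * ((fine (mrestr mu mB setT))^-1)%:E)%E) => //.
by rewrite bE (prE mu mEB) -EFinM.
Qed.

Lemma conditional_invariant mu B (mB : measurable B) : 0 < pr mu B ->
  shift_invariant mu -> left_shift @^-1` B = B -> shift_invariant (conditional mu mB).
Proof.
move=> B0 smu iB E mE; have mE' := measurable_left_shift mE.
rewrite !prE// !conditionalE//; congr (_ / _)%:E.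
rewrite -{1}iB -preimage_setI /pr smu//; exact: measurableI.
Qed.

Lemma conditional_full mu B (mB : measurable B) E : 0 < pr mu B -> measurable E ->
  pr mu E = 1 -> pr (conditional mu mB) E = 1.
Proof.
move=> B0 mE E1; rewrite conditionalE//.
have -> : pr mu (E `&` B) = pr mu B; last by rewrite divff// gt_eqF.
rewrite [RHS](prID mu mB mE) setIC -[LHS]addr0; congr (_ + _).
apply/esym/eqP; rewrite eq_le pr_ge0 andbT.
have <- : pr mu (~` E) = 0 by rewrite pr_setC// E1 subrr.
by apply: pr_le => [||x []//]; [exact: measurableD|exact: measurableC].
Qed.

Lemma conditional_entropy mu B (mB : measurable B) n : 0 < pr mu B ->
  - \sum_(w : n.-tuple A) pr mu (window 1 n [set tval w] `&` B) *
      ln (pr mu (window 1 n [set tval w] `&` B)) =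
  pr mu B * entropy (conditional mu mB) n - pr mu B * ln (pr mu B).
Proof.
move=> B0; set p := pr mu B.
have mW (w : n.-tuple A) := measurable_window 1 n [set tval w].
have wE (w : n.-tuple A) : pr mu (window 1 n [set tval w] `&` B) =
    p * wprob (conditional mu mB) w.
  rewrite /wprob size_tuple conditionalE//.
  by rewrite -/p mulrCA divff ?mulr1// gt_eqF.
rewrite /entropy mulrN -opprD; congr (- _).
rewrite mulr_sumr -[X in _ = _ + X]mulr1 -(sum_wprob (conditional mu mB) n).
rewrite mulr_sumr -big_split/=; apply: eq_bigr => w _; rewrite wE.
have := wprob_ge0 (conditional mu mB) w; rewrite le_eqVlt => /predU1P[<-|w0].
  by rewrite !(mulr0, mul0r) addr0.
by rewrite lnM// -/p; ring.
Qed.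

Lemma entropy_decomposition mu B n : measurable B ->
  entropy mu n <=
  - \sum_(w : n.-tuple A) pr mu (window 1 n [set tval w] `&` B) *
      ln (pr mu (window 1 n [set tval w] `&` B))
  - \sum_(w : n.-tuple A) pr mu (window 1 n [set tval w] `&` ~` B) *
      ln (pr mu (window 1 n [set tval w] `&` ~` B)).
Proof.
move=> mB; rewrite /entropy -opprD lerN2 -big_split/=; apply: ler_sum => w _.
have mW := measurable_window 1 n [set tval w].
rewrite /wprob size_tuple; rewrite (prID mu mW mB) -setDE.
set s := pr mu (_ `&` B); set t := pr mu (_ `\` B).
have s0 : 0 <= s := pr_ge0 _ _.
have t0 : 0 <= t := pr_ge0 _ _.
have mono (x y : R) : 0 <= x -> 0 <= y -> x * ln x <= x * ln (x + y).
  rewrite le_eqVlt => /predU1P[<-|x0] y0; first by rewrite !mul0r.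
  by rewrite ler_wpM2l ?(ltW x0)// ler_ln ?posrE ?lerDl// ltr_wpDr.
by rewrite mulrDl lerD ?mono// addrC mono.
Qed.

End Conditioning.

Section AllErgodic.
Context {A : alphabetType} {R : realType} (X : set (full_shift A)).
Hypothesis hX : subshift X.
Variable C : R.
Hypothesis hC : forall n,
  (wcard n (language X))%:R <= C * expR (n%:R * top_entropy R X).
Implicit Types (mu nu : probability (full_shift A) R) (B E : set (full_shift A)).

Let h := top_entropy R X.

(** Splitting each cylinder along B changes the entropy by a bounded amount, and
    the part outside B contributes at most mu (~` B) (n h + const), so the part
    inside B must account for mu B (n h) up to a constant. *)
Lemma conditional_mme mu B (mB : measurable B) : 0 < pr mu B ->
  left_shift @^-1` B = B -> max_entropy_measure X mu ->
  max_entropy_measure X (conditional mu mB).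
Proof.
move=> B0 iB mmu; have [smu muX _] := mmu.
have mX := measurable_subshift hX.
have condX D (mD : measurable D) : 0 < pr mu D -> conditional mu mD X = 1%E.
  by move=> D0; rewrite prE//; congr EFin; apply: conditional_full => //; rewrite /pr muX.
have mBC : measurable (~` B) by exact: measurableC.
set p := pr mu B; set q := pr mu (~` B).
have p1 : p + q = 1 by rewrite /q pr_setC//; rewrite -/p; lra.
pose c := (- (p * ln p) + q * (ln C + ln 2) - q * ln q) / p.
apply: (@entropy_ge_mme _ _ X hX C hC _ c); [exact: conditional_invariant|exact: condX|].
move=> n; have := mme_entropy_ge hX n mmu.
have := entropy_decomposition mu n mB; rewrite conditional_entropy// -/p.
have : - \sum_(w : n.-tuple A) pr mu (window 1 n [set tval w] `&` ~` B) *
      ln (pr mu (window 1 n [set tval w] `&` ~` B)) <=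
    q * (n%:R * h + ln C + ln 2) - q * ln q.
  have := pr_ge0 mu (~` B); rewrite le_eqVlt => /predU1P[q0|q0].
    rewrite /q -q0 !mul0r subrr big1 ?oppr0// => w _.
    suff -> : pr mu (window 1 n [set tval w] `&` ~` B) = 0 by rewrite mul0r.
    apply/eqP; rewrite eq_le pr_ge0 andbT q0; apply: pr_le => [||x []//]; last exact: mBC.
    by apply: measurableI => //; exact: measurable_window.
  rewrite (conditional_entropy mBC)// -/q lerD2r ler_wpM2l ?(ltW q0)//.
  by apply: entropy_le => //; exact: condX.
move=> h1 h2 h3; rewrite lerBlDr -(ler_pM2l B0) -/p.
rewrite mulrDr /c [p * (_ / p)]mulrCA divff ?gt_eqF// mulr1 -/h.
have q1 : q = 1 - p by lra.
move: h1 h2 h3; rewrite q1 -/h; lra.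
Qed.

Lemma pos_lower_bound (f : nat -> R) K : (forall i, (i < K)%N -> 0 < f i) ->
  exists2 d, 0 < d & forall i, (i < K)%N -> d <= f i.
Proof.
elim: K => [|K ih] f0; first by exists 1.
have [i iK|d d0 df] := ih; first by apply: f0; lia.
exists (Num.min d (f K)); first by rewrite lt_min d0 f0.
move=> i; rewrite ltnS leq_eqVlt => /predU1P[->|iK]; first by rewrite ge_min lexx orbT.
by rewrite ge_min df.
Qed.

Definition invariant_part mu B :=
  [/\ measurable B, left_shift @^-1` B = B & 0 < pr mu B].

(** The conditional measures on disjoint invariant sets are measures of maximal
    entropy. Approximating the sets by conditions on one window gives disjoint
    sets of words of conditional measure at least 1/2, each of which contains at
    least a fixed fraction of exp (n h) words by [mme_wcard_ge]; the language has
    room for boundedly many. This replaces the ergodic decomposition theorem. *)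
Lemma invariant_parts_bounded mu : max_entropy_measure X mu ->
  exists N, forall K (B : nat -> set (full_shift A)),
    (forall i, (i < K)%N -> invariant_part mu (B i)) ->
    (forall i j, (i < K)%N -> (j < K)%N -> i != j -> B i `&` B j = set0) -> (K <= N)%N.
Proof.
move=> mmu; have half0 : (0 : R) < 1 / 2 by rewrite divr_gt0.
have [smu muX _] := mmu.
pose c := density C (1 / 2); have c0 : 0 < c := density_gt0 C (1 / 2).
have C0 : 0 <= C := le_trans ler01 (growth_constant_ge1 hX hC).
exists (Num.Def.archi_bound (C / c)) => K B hB dB.
have [d d0 dmin] : exists2 d, 0 < d & forall i, (i < K)%N -> d <= pr mu (B i).
  by apply: pos_lower_bound => i /hB[].
(* The approximation errors of all K sets together stay below half of the
   smallest measure. *)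
pose e := d / (2 * K.+1%:R).
have e0 : 0 < e by rewrite divr_gt0// mulr_gt0// ltr0n.
have eK : e * K.+1%:R = d / 2 by rewrite /e invfM mulrA -mulrA mulVf ?mulr1.
have /choice[f hf] : forall i, exists f : nat * set (full_shift A), (i < K)%N ->
    local f.1 f.2 /\ pr mu (B i `+` f.2) < e.
  move=> i; have [iK|iK] := ltnP i K; last by exists (0%N, set0).
  have [mB _ _] := hB i iK.
  have [_ /(_ e e0) [M [P [lP h1 _]]]] := measurable_approximable mu mu mB.
  by exists (M, P).
pose M := \max_(i < K) (f i).1.
have /choice[Q hQ] : forall i, exists Q, (i < K)%N ->
    (f i).2 = window (- M%:Z) (M + M).+1 Q.
  move=> i; have [iK|iK] := ltnP i K; last by exists set0.
  have [lf _] := hf i iK.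
  have /local_window[Q QE] : local M (f i).2.
    by apply: local_le lf; exact: (@leq_bigmax _ (fun i : 'I_K => (f i).1) (Ordinal iK)).
  by exists Q.
pose D i := [set w | Q i w /\ forall j, (j < K)%N -> j != i -> ~ Q j w].
pose n := (M + M).+1.
have mW D' : measurable (window (- M%:Z) n D' : set (full_shift A)) by exact: measurable_window.
have DE i : (i < K)%N -> c * expR (n%:R * h) <= (wcard n (D i `&` language X))%:R.
  move=> iK; have [mB iB B0] := hB i iK.
  have mme_i := conditional_mme mB B0 iB mmu.
  have [si Xi _] := mme_i.
  apply: (mme_wcard_ge hX hC mme_i half0).
  rewrite (pr_window_language hX)// -(pr_window_invariant si (- M%:Z)) conditionalE//.
  rewrite ler_pdivlMr//.
  have mU : measurable (\big[setU/set0]_(j < K | val j != i) (B i `&` window (- M%:Z) n (Q j))).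
    by apply: bigsetU_measurable => j _; exact: measurableI.
  have mDif : measurable (B i `\` window (- M%:Z) n (Q i)) by exact: measurableD.
  have mI : measurable (window (- M%:Z) n (D i) `&` B i) by exact: measurableI.
  have sub : B i `<=` (window (- M%:Z) n (D i) `&` B i) `|` ((B i `\` window (- M%:Z) n (Q i)) `|`
      \big[setU/set0]_(j < K | val j != i) (B i `&` window (- M%:Z) n (Q j))).
    move=> x Bx; case: (pselect (window (- M%:Z) n (Q i) x)) => Qx; last by right; left.
    case: (pselect (exists2 j : 'I_K, val j != i & window (- M%:Z) n (Q j) x)).
      by move=> [j ji Qj]; right; right; rewrite -bigcup_seq_cond; exists j => //=; rewrite mem_index_enum.
    move=> nQ; left; split => //; split => // j jK ji Qj; apply: nQ.
    by exists (Ordinal jK).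
  have mR := measurableU _ _ mDif mU.
  have h1 := pr_le mu mB (measurableU _ _ mI mR) sub.
  have h2 := prU_le mu mI mR.
  have h3 := prU_le mu mDif mU.
  have h4 : pr mu (B i `\` window (- M%:Z) n (Q i)) <= e.
    apply: (@le_trans _ _ (pr mu (B i `+` (f i).2))); last by apply: ltW; exact: (hf i iK).2.
    rewrite (hQ i iK); apply: pr_le => //; first exact: measurableY.
    by rewrite setY_def; exact: subsetUl.
  have h5 : pr mu (\big[setU/set0]_(j < K | val j != i) (B i `&` window (- M%:Z) n (Q j))) <= K%:R * e.
    apply: le_trans (pr_sum_le _ _ _ _) _; first by move=> j; exact: measurableI.
    apply: (@le_trans _ _ (\sum_(j < K) e)); last by rewrite sumr_const card_ord mulr_natl.
    rewrite big_mkcond/=; apply: ler_sum => j _; case: ifP => ji; last exact: ltW.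
    have [mBj _ _] := hB j (ltn_ord j).
    apply: (@le_trans _ _ (pr mu (B j `+` (f j).2))); last by apply: ltW; exact: (hf j (ltn_ord j)).2.
    rewrite (hQ j (ltn_ord j)); apply: pr_le; [exact: measurableI|exact: measurableY|].
    rewrite setY_def => x [Bi Qj]; right; split => // Bj.
    by have /seteqP[/(_ x) + _] := dB i j iK (ltn_ord j) ltac:(by rewrite eq_sym ji); apply.
  have dB' := dmin i iK; have h6 : K%:R * e + e <= d / 2 by rewrite -eK -natr1; lra.
  move: h1 h2 h3 h4 h5 h6 dB'; lra.
have total : (\sum_(i < K) wcard n (D i `&` language X) <= wcard n (language X))%N.
  apply: (@wcard_sum_le _ n K (fun i => D i `&` language X)) => [i _ u []//|i j /andP[ij jK]].
  apply/seteqP; split => // u [[[Qi _] _] [[_ Dj] _]].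
  by apply: (Dj i) => //; [exact: ltn_trans ij jK|rewrite ltn_eqF].
rewrite leqNgt; apply/negP => NK.
have := hC n; rewrite leNgt => /negP; apply.
apply: (@lt_le_trans _ _ (K%:R * c * expR (n%:R * h))).
  rewrite ltr_pM2r ?expR_gt0// -ltr_pdivrMr//.
  apply: (lt_trans (archi_boundP _)); first by rewrite divr_ge0// ltW.
  by rewrite ltr_nat.
apply: (@le_trans _ _ (\sum_(i < K) wcard n (D i `&` language X))%N%:R); last by rewrite ler_nat.
rewrite natr_sum -mulrA mulr_natl -[X in _ *+ X]card_ord -sumr_const.
by apply: ler_sum => i _; exact: DE.
Qed.

Definition atom mu B := invariant_part mu B /\
  forall E, measurable E -> left_shift @^-1` E = E -> E `<=` B ->
    pr mu E = 0 \/ pr mu E = pr mu B.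

(** Otherwise every invariant set of positive measure inside B splits again,
    producing more disjoint invariant sets than [invariant_parts_bounded]
    allows. *)
Lemma atom_exists mu B : max_entropy_measure X mu -> invariant_part mu B ->
  exists2 B', B' `<=` B & atom mu B'.
Proof.
move=> mmu hB; apply: contrapT => nex.
have noatom B' : B' `<=` B -> ~ atom mu B' by move=> sB aB; apply: nex; exists B'.
have [N hN] := invariant_parts_bounded mmu.
suff parts K D : invariant_part mu D -> D `<=` B -> exists2 F : nat -> set (full_shift A),
    (forall i, (i < K)%N -> invariant_part mu (F i) /\ F i `<=` D) &
    (forall i j, (i < K)%N -> (j < K)%N -> i != j -> F i `&` F j = set0).
  have [F hF dF] := parts N.+1 B hB (fun=> id).
  by have := hN N.+1 F (fun i iN => (hF i iN).1) dF; rewrite ltnn.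
elim: K D => [|K ih] D hD DB; first by exists (fun=> set0).
have [mD iD D0] := hD.
have [E [mE iE ED nE]] : exists E, [/\ measurable E, left_shift @^-1` E = E, E `<=` D &
    pr mu E <> 0 /\ pr mu E <> pr mu D].
  apply: contrapT => nE; apply: (noatom D DB); split => // E mE iE ED.
  apply: contrapT => /not_orP[E0 E1]; apply: nE; by exists E.
have mDE : measurable (D `\` E) by exact: measurableD.
have sum := prID mu mD mE.
have DE : D `&` E = E by apply/seteqP; split => x; [case|move=> Ex; split => //; exact: ED].
have E0 : 0 < pr mu E by rewrite lt_neqAle pr_ge0 andbT eq_sym; apply/eqP; case: nE.
have DE0 : 0 < pr mu (D `\` E).
  rewrite lt_neqAle pr_ge0 andbT; apply/eqP => z.
  by case: nE => _; apply; rewrite sum DE -z addr0.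
have [||F hF dF] := ih (D `\` E).
- by split => //; rewrite setDE preimage_setI -preimage_setC iD iE.
- by move=> x [/DB].
exists (fun i => if i is j.+1 then F j else E).
  case=> [_|i iK]; first by split.
  have [hi si] := hF i iK; split => // x /si[]//.
case=> [|i] [|j]//= iK jK ij; last exact: dF.
  by have [_ sj] := hF j jK; apply/seteqP; split => // x [Ex /sj[]].
by have [_ si] := hF i iK; apply/seteqP; split => // x [/si[] _ nEx Ex].
Qed.

Lemma atom_ergodic mu B (mB : measurable B) : shift_invariant mu -> atom mu B ->
  ergodic (conditional mu mB).
Proof.
move=> smu [[_ iB B0] hB]; split; first exact: conditional_invariant.
move=> E mE iE; have mEB : measurable (E `&` B) by exact: measurableI.
rewrite prE// conditionalE//.
have [||->|->] := hB _ mEB.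
- by rewrite preimage_setI iE iB.
- by move=> x [].
- by left; rewrite mul0r.
- by right; rewrite divff// gt_eqF.
Qed.

(** Conditioning on an atom gives an ergodic measure of maximal entropy. Two
    disjoint atoms would give two different ones, so the first atom found has
    full measure. *)
Lemma mme_ergodic : (forall mu nu, ergodic mu -> max_entropy_measure X mu ->
    ergodic nu -> max_entropy_measure X nu -> same_measure mu nu) ->
  forall mu, max_entropy_measure X mu -> ergodic mu.
Proof.
move=> uniq mu mmu; have [smu muX _] := mmu.
have [|B _ aB] := @atom_exists mu setT mmu.
  by split => //; rewrite pr_setT.
have [[mB iB B0] hB] := aB.
have BC0 : pr mu (~` B) = 0.
  apply/eqP; apply: contrapT => /negP BCn0.
  have [|B' sB' aB'] := @atom_exists mu (~` B) mmu.
    split; [exact: measurableC|by rewrite -preimage_setC iB|].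
    by rewrite lt_neqAle pr_ge0 andbT eq_sym.
  have [[mB' iB' B'0] hB'] := aB'.
  have := uniq _ _ (atom_ergodic mB smu aB) (conditional_mme mB B0 iB mmu)
    (atom_ergodic mB' smu aB') (conditional_mme mB' B'0 iB' mmu).
  move=> /(_ B mB) /(congr1 fine); rewrite -/(pr _ B) -/(pr _ B).
  rewrite !conditionalE// setIid divff ?gt_eqF//.
  have -> : B `&` B' = set0 by apply/seteqP; split => // x [Bx /sB'].
  by rewrite pr_set0 mul0r => /eqP; rewrite oner_eq0.
have B1 : pr mu B = 1 by have := pr_setC mu mB; lra.
split => // E mE iE; have mEB : measurable (E `&` B) by exact: measurableI.
have EB : pr mu E = pr mu (E `&` B).
  rewrite (prID mu mE mB) -[RHS]addr0; congr (_ + _).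
  apply/eqP; rewrite eq_le pr_ge0 andbT -BC0.
  by apply: pr_le => [||x []//]; [exact: measurableD|exact: measurableC].
rewrite prE// EB; have [||->|->] := hB _ mEB.
- by rewrite preimage_setI iE iB.
- by move=> x [].
- by left.
- by right; rewrite B1.
Qed.

End AllErgodic.

(** * Existence of a measure of maximal entropy *)

Lemma ultrafilter_fmap (T T' : Type) (U : set_system T) (f : T -> T') :
  UltraFilter U -> UltraFilter (f @ U).
Proof.
move=> UU; have PU := @ultra_proper _ _ UU; split; first exact: fmap_proper_filter.
move=> G PG sUG; apply/seteqP; split => // B GB.
have [//|UB] := in_ultra_setVsetC (f @^-1` B) UU.
have /sUG GnB : (f @ U) (~` B) by [].
by have [x []] := filter_ex (filterI GB GnB).
Qed.

Lemma ultrafilter_cvg (R : realType) (T : Type) (U : set_system T) (f : T -> R) (a b : R) :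
  UltraFilter U -> (forall t, a <= f t <= b) -> exists l : R, f @ U --> l.
Proof.
move=> UU fab; have := @segment_compact R a b; rewrite compact_ultra.
move=> /(_ (f @ U) (ultrafilter_fmap f UU)) [|l [_ cl]]; last by exists l.
have PU := @ultra_proper _ _ UU.
by apply: (@filterS _ U _ setT) filterT => t _; rewrite /= in_itv /=.
Qed.

Section Existence.
Context {A : alphabetType} {R : realType} (X : set (full_shift A)).
Hypothesis hX : subshift X.
Variable C : R.
Hypothesis hC : forall n,
  (wcard n (language X))%:R <= C * expR (n%:R * top_entropy R X).
Implicit Types (B D : set (full_shift A)).

Let h := top_entropy R X.
Let L n : {set n.-tuple A} := wset n (language X).

(** A word containing u at position i is determined by what precedes and what
    follows u. *)
Lemma occurrences_le n i k (u : seq A) : (i + k <= n)%N ->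
  (wcard n (language X `&` [set w | take k (drop i w) = u]) <=
   wcard i (language X) * wcard (n - (i + k)) (language X))%N.
Proof.
move=> ikn; rewrite !wcardE -cardsX.
have s1 (t : n.-tuple A) : size (take i t) == i.
  by rewrite size_takel// size_tuple; lia.
have s2 (t : n.-tuple A) : size (drop (i + k) t) == (n - (i + k))%N.
  by rewrite size_drop size_tuple.
pose f (t : n.-tuple A) : i.-tuple A * (n - (i + k)).-tuple A := (Tuple (s1 t), Tuple (s2 t)).
have decomp (t : n.-tuple A) : tval t = take i t ++ take k (drop i t) ++ drop (i + k) t.
  by rewrite addnC -drop_drop !cat_take_drop.
rewrite -(card_in_imset (f := f)); last first.
  move=> t t' /in_wset[_ /= tu] /in_wset[_ /= tu'] [e1 e2].
  by apply/val_inj; rewrite /= (decomp t) (decomp t') e1 e2 tu tu'.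
apply/subset_leq_card/fintype.subsetP => _ /imsetP[t /in_wset[Lt _] ->].
rewrite finset.in_setX; apply/andP; split; apply/in_wset => /=.
  exact: language_take.
exact: language_drop.
Qed.

Lemma language_point_choice n : exists f : n.-tuple A -> full_shift A,
  forall w, w \in L n -> X (f w) /\ subword (f w) 1 n = w.
Proof.
have [[x0 _] _ _] := hX.
have /choice[f hf] : forall w : n.-tuple A, exists x, w \in L n -> X x /\ subword x 1 n = w.
  move=> w; have [/in_wset Lw|nL] := boolP (w \in L n); last by exists x0.
  have [x Xx xw] := (languageP hX w).1 Lw; exists x => _.
  by rewrite size_tuple in xw.
by exists f.
Qed.

(** A point of the subshift that shows the word w of its language at the
    coordinates 1, ..., n. *)
Definition language_point n := projT1 (cid (language_point_choice n)).

Lemma language_pointP n w : w \in L n ->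
  X (language_point w) /\ subword (language_point w) 1 n = w.
Proof. exact: (projT2 (cid (language_point_choice n))). Qed.

Let visits n B : nat :=
  \sum_(w in L n.+1) \sum_(i < n.+1) `[< B (translate i%:Z (language_point w)) >].

(** The average over the words of length n + 1 of the empirical measures of n + 1
    consecutive shifts of a point showing the word. It is finitely additive on
    all sets, so a limit along an ultrafilter is too. *)
Definition empirical n B : R := (visits n B)%:R / (n.+1 * #|L n.+1|)%:R.

Let L_gt0 n : (0 < #|L n|)%N.
Proof. by rewrite /L -wcardE wcard_language_gt0. Qed.

Let total_gt0 n : (0 : R) < (n.+1 * #|L n.+1|)%:R.
Proof. by rewrite ltr0n muln_gt0 L_gt0. Qed.

Lemma empirical_ge0 n B : 0 <= empirical n B.
Proof. by rewrite divr_ge0. Qed.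

Lemma empirical_full n B : X `<=` B -> empirical n B = 1.
Proof.
move=> XB; rewrite /empirical; suff -> : visits n B = (n.+1 * #|L n.+1|)%N.
  by rewrite divff// gt_eqF ?total_gt0.
rewrite /visits (eq_bigr (fun=> n.+1)); first by rewrite sum_nat_const mulnC.
move=> w wL; rewrite (eq_bigr (fun=> 1%N)) ?sum_nat_const ?card_ord ?muln1// => i _.
apply/eqP; rewrite eqb1; apply/asboolP; apply: XB; apply: subshift_translate => //.
by have [] := language_pointP wL.
Qed.

Lemma empiricalU n B D : B `&` D = set0 ->
  empirical n (B `|` D) = empirical n B + empirical n D.
Proof.
move=> BD; rewrite /empirical -mulrDl -natrD; congr (_%:R / _).
rewrite /visits -big_split/=; apply: eq_bigr => w _.
rewrite -big_split/=; apply: eq_bigr => i _; set x := translate _ _.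
have nBD : ~ (B x /\ D x) by move=> BDx; have /seteqP[/(_ x BDx)] := BD.
case: (asboolP (B x)) => Bx; case: (asboolP (D x)) => Dx; case: asboolP => BDx //;
  by exfalso; move: BDx; rewrite /setU /=; tauto.
Qed.

Lemma empirical_le1 n B : empirical n B <= 1.
Proof.
rewrite -(@empirical_full n setT)// -(setvU B) empiricalU; last by rewrite setICl.
by rewrite lerDr empirical_ge0.
Qed.

(** The sum over shifts telescopes, leaving the two boundary terms. *)
Lemma empirical_shift n B :
  `|empirical n (left_shift @^-1` B) - empirical n B| <= n.+1%:R^-1.
Proof.
have inv0 : (0 : R) <= ((n.+1 * #|L n.+1|)%:R)^-1 by rewrite invr_ge0.
rewrite /empirical -mulrBl normrM (ger0_norm inv0).
rewrite natrM invfM mulrCA ler_piMr ?invr_ge0// ler_pdivrMr ?ltr0n// mul1r.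
rewrite /visits !natr_sum -sumrB (le_trans (ler_norm_sum _ _ _))//.
rewrite -sum1_card natr_sum; apply: ler_sum => w _.
set x := language_point _.
have -> : (\sum_(i < n.+1) `[< (left_shift @^-1` B) (translate i%:Z x) >] =
    \sum_(i < n.+1) `[< B (translate i.+1%:Z x) >])%N.
  apply: eq_bigr => i _; congr nat_of_bool; congr asbool.
  by rewrite /preimage /= left_shiftE translate_add; congr (B (translate _ x)); lia.
pose b (i : nat) : nat := `[< B (translate i%:Z x) >].
have -> : (\sum_(i < n.+1) `[< B (translate i.+1%:Z x) >] = \sum_(i < n) b i.+1 + b n.+1)%N.
  by rewrite big_ord_recr.
have -> : (\sum_(i < n.+1) `[< B (translate i%:Z x) >] = b 0 + \sum_(i < n) b i.+1)%N.
  by rewrite big_ord_recl; congr (_ + _)%N; apply: eq_bigr.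
rewrite !natrD; set s := (\sum_(i < n) b i.+1)%:R.
have -> : s + (b n.+1)%:R - ((b 0%N)%:R + s) = (b n.+1)%:R - (b 0%N)%:R by ring.
rewrite /b; case: asbool; case: asbool.
  all: by rewrite ?subrr ?normr0 ?subr0 ?sub0r ?normrN ?normr1.
Qed.

(** Counts the shifts so late that a window of length k overruns the word. *)
Lemma sum_late_le N k : (\sum_(i < N) (N < i + k) <= k)%N.
Proof.
suff bnd M : (\sum_(i < M) (N < i + k) <= M + k - N)%N.
  by apply: leq_trans (bnd N) _; lia.
elim: M => [|M ih]; first by rewrite big_ord0.
by rewrite big_ord_recr /=; move: ih; case: ltnP => /=; lia.
Qed.

(** If the window fits into the word, [occurrences_le] and the growth hypothesis
    allow at most C^2 exp ((N - k) h) words, and there are at least exp (N h). *)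
Lemma occurrence_count_le N i k (u : k.-tuple A) :
  (#|[set w in L N | `[< window 1 k [set tval u] (translate i%:Z (language_point w)) >]]|%:R : R)
  <= #|L N|%:R * (C ^+ 2 * expR (- (k%:R * h)) + (N < i + k)%:R).
Proof.
have C1 := growth_constant_ge1 hX hC.
have B0 : 0 <= C ^+ 2 * expR (- (k%:R * h)) by rewrite mulr_ge0 ?expR_ge0// exprn_ge0// (le_trans ler01).
have [ikN|ikN] := leqP (i + k) N; last first.
  apply: (@le_trans _ _ #|L N|%:R); last by rewrite ler_peMr// lerDr.
  rewrite ler_nat; apply/subset_leq_card/fintype.subsetP => w.
  by rewrite finset.inE => /andP[].
rewrite addr0.
apply: (@le_trans _ _ (wcard i (language X) * wcard (N - (i + k)) (language X))%N%:R).
  rewrite ler_nat; apply: leq_trans (occurrences_le u ikN); rewrite wcardE.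
  apply/subset_leq_card/fintype.subsetP => w; rewrite finset.inE => /andP[wL /asboolP].
  rewrite /window /= subword_translate => xu; apply/in_wset; split; first exact/in_wset.
  have [_ xw] := language_pointP wL.
  by rewrite /= -xw drop_subword ?take_subword//; lia.
rewrite natrM; apply: le_trans (ler_pM _ _ (hC i) (hC (N - (i + k)))) _ => //.
apply: (@le_trans _ _ (C ^+ 2 * expR (- (k%:R * h)) * expR (N%:R * h))).
  rewrite mulrACA -expr2 -/h -[leRHS]mulrA -!expRD; apply: ler_wpM2l.
    by rewrite exprn_ge0// (le_trans ler01).
  rewrite ler_expR le_eqVlt; apply/orP; left; apply/eqP.
  by rewrite natrB// natrD; ring.
rewrite [leRHS]mulrC; apply: ler_wpM2l => //.
by rewrite /L -wcardE; exact: wcard_ge.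
Qed.

Lemma empirical_word n k (u : k.-tuple A) :
  empirical n (window 1 k [set tval u]) <=
  C ^+ 2 * expR (- (k%:R * h)) + k%:R * n.+1%:R^-1.
Proof.
set b := C ^+ 2 * _.
rewrite /empirical ler_pdivrMr ?total_gt0// /visits exchange_big/= natr_sum.
apply: (@le_trans _ _ (\sum_(i < n.+1) (#|L n.+1|%:R * (b + (n.+1 < i + k)%:R)))).
  apply: ler_sum => i _; apply: le_trans (occurrence_count_le n.+1 i u).
  by rewrite ler_nat -sum1dep_card big_mkcondr/= leq_sum// => w wL; case: asbool.
rewrite -mulr_sumr big_split/= sumr_const card_ord -natr_sum.
have lk : (\sum_(i < n.+1) (n.+1 < i + k))%N%:R <= k%:R :> R by rewrite ler_nat sum_late_le.
have N0 : (0 : R) < n.+1%:R by rewrite ltr0n.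
have -> : (b + k%:R / n.+1%:R) * (n.+1 * #|L n.+1|)%:R = #|L n.+1|%:R * (b *+ n.+1 + k%:R).
  by rewrite natrM -(mulr_natr b); field; rewrite gt_eqF.
by apply: ler_wpM2l => //; rewrite lerD2l.
Qed.

(** An ultrafilter limit of the empirical measures is finitely additive and
    invariant, and [empirical_word] gives each word of length k measure at most
    C^2 exp (- k h). Hence entropy mu k >= k h - ln (C^2), which is enough by
    [entropy_ge_mme]. *)
Lemma mme_exists : exists mu : probability (full_shift A) R, max_entropy_measure X mu.
Proof.
have [U [UU sU]] := ultraFilterLemma (eventually_filter : ProperFilter \oo).
have PU := @ultra_proper _ _ UU.
have /choice[m hm] : forall B, exists l : R, (fun n => empirical n B) @ U --> l.
  by move=> B; apply: (@ultrafilter_cvg _ _ _ _ 0 1) => n; rewrite empirical_ge0 empirical_le1.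
have limE B l : (fun n => empirical n B) @ U --> l -> m B = l.
  by move=> cl; apply: (cvg_unique _ (hm B) cl).
have m_ge0 B : 0 <= m B.
  rewrite -(cvg_lim _ (hm B))//; apply: limr_ge; first by apply/cvg_ex; exists (m B); exact: hm.
  by apply: nearW => n; exact: empirical_ge0.
have mT : m setT = 1.
  apply: limE; rewrite (_ : (fun n => _) = cst 1); first exact: cvg_cst.
  by apply/funext => n; rewrite empirical_full.
have mU B D : B `&` D = set0 -> m (B `|` D) = m B + m D.
  move=> BD; apply: limE; rewrite (_ : (fun n => _) = (fun n => empirical n B + empirical n D)).
    by apply: cvgD; exact: hm.
  by apply/funext => n; rewrite empiricalU.
(* The ultrafilter contains the tails, so limits at infinity persist. *)
have hoo : (fun n => n.+1%:R^-1 : R) @ U --> (0 : R).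
  by move=> V V0; apply: sU; exact: (@cvg_harmonic R V V0).
have mS B : m (left_shift @^-1` B) = m B.
  apply: limE; have c0 : (fun n => empirical n (left_shift @^-1` B) - empirical n B) @ U --> (0 : R).
    apply: norm_cvg0; apply: (squeeze_cvgr _ (cvg_cst (0 : R)) hoo).
    by apply: nearW => n; rewrite normr_ge0 /=; exact: empirical_shift.
  have c1 : (fun n => empirical n (left_shift @^-1` B) - empirical n B + empirical n B) @ U -->
      0 + m B by apply: cvgD => //; exact: hm.
  rewrite add0r in c1; rewrite (_ : (fun n => _) = (fun n => empirical n (left_shift @^-1` B))) in c1 => //.
  by apply/funext => n; rewrite subrK.
have [mu muE] := local_content_extends m_ge0 mT mU.
have mX := measurable_subshift hX.
exists mu.
have muX : mu X = 1%E.
  rewrite prE//; congr EFin; rewrite -(setCK X) pr_setC; last exact: measurableC.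
  suff -> : pr mu (~` X) = 0 by rewrite subr0.
  have oX : open (~` X) by rewrite openC; have [] := hX.
  rewrite (open_bigcup_local oX).
  have cU := pr_bigcup (mu := mu) (fun M => local_measurable (@interior_at_local _ M (~` X)))
    (@interior_at_mono _ (~` X)).
  apply: (cvg_unique _ cU) => //.
  rewrite (_ : (fun M => _) = cst 0); first exact: cvg_cst.
  apply/funext => M; rewrite (muE M); last exact: interior_at_local.
  have := mU (interior_at M (~` X)) (~` interior_at M (~` X)) (setICr _).
  rewrite setUv mT; suff -> : m (~` interior_at M (~` X)) = 1 by move=> e; rewrite /cst; lra.
  apply: limE; rewrite (_ : (fun n => _) = cst 1); first exact: cvg_cst.
  apply/funext => n; rewrite empirical_full// => x Xx hx.
  by have := hx x (fun i _ => erefl); apply.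
have smu : shift_invariant mu.
  have mf : measurable_fun setT (@left_shift A).
    by move=> _ B mB; rewrite setTI; exact: measurable_left_shift.
  pose f : {mfun (full_shift A) >-> (full_shift A)} :=
    HB.pack (@left_shift A) (isMeasurableFun.Build _ _ _ _ _ mf).
  move=> B mB; apply: (local_same_measure (mu := distribution mu f) (nu := mu)) => // M P lP.
  have mP := local_measurable lP; have mP' := measurable_left_shift mP.
  transitivity (mu (left_shift @^-1` P)) => //.
  have lP' : local M.+1 (left_shift @^-1` P).
    by move=> x y xy; apply: lP => i hi; apply: xy; lia.
  by rewrite !prE//; rewrite (muE _ _ lP) (muE _ _ lP') mS.
have C1 := growth_constant_ge1 hX hC.
apply: (@entropy_ge_mme _ _ X hX C hC mu (ln (C ^+ 2))) => // k.
have wle (u : k.-tuple A) : wprob mu u <= C ^+ 2 * expR (- (k%:R * h)).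
  rewrite /wprob size_tuple (muE _ _ (@window_local _ 1 k _)).
  have c2 : (fun n => C ^+ 2 * expR (- (k%:R * h)) + k%:R * n.+1%:R^-1) @ U -->
      C ^+ 2 * expR (- (k%:R * h)) + k%:R * 0.
    by apply: cvgD; [exact: cvg_cst|apply: cvgM => //; exact: cvg_cst].
  rewrite mulr0 addr0 in c2.
  apply: (ler_cvg_to (hm _) c2).
  by apply: nearW => n; exact: empirical_word.
rewrite /entropy -[leLHS]mul1r -[X in X * _](sum_wprob mu k) mulr_suml -sumrN.
apply: ler_sum => u _; have := wprob_ge0 mu u; rewrite le_eqVlt => /predU1P[<-|u0].
  by rewrite !mul0r oppr0.
rewrite -mulrN; apply: ler_wpM2l; first exact: ltW.
have C2 : 0 < C ^+ 2 by rewrite exprn_gt0// (lt_le_trans ltr01).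
have : ln (wprob mu u) <= ln (C ^+ 2 * expR (- (k%:R * h))).
  by rewrite ler_ln ?posrE// mulr_gt0// expR_gt0.
by rewrite lnM ?posrE ?expR_gt0// expRK -/h; lra.
Qed.

End Existence.

(** * Uniqueness of the measure of maximal entropy *)

Theorem theorem3p2 (R : realType) (A : alphabetType) (X : set (full_shift A))
  (hX : subshift X)
  (hcard : exists C : R, forall n : nat,
    (language_card X n)%:R < C * expR (n%:R * top_entropy R X))
  (G : set (seq A)) (hG : G `<=` language X)
  (gap : nat)
  (hgap : forall v w : seq A, G v -> G w ->
    exists y : gap.-tuple A, language X (v ++ y ++ w))
  (hmu : forall mu : probability (full_shift A) R,
    ergodic mu -> max_entropy_measure X mu ->
    exists eps : R, 0 < eps /\
      exists S : set nat, syndetic S /\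
        forall n : nat, S n -> (eps%:E < measure_of_words X mu G n)%E) :
  exists mu : probability (full_shift A) R,
    max_entropy_measure X mu /\
    forall nu : probability (full_shift A) R,
      max_entropy_measure X nu -> same_measure nu mu.
Proof.
have [C hC'] := hcard.
have hC n : (wcard n (language X))%:R <= C * expR (n%:R * top_entropy R X).
  exact: ltW (hC' n).
have charged (mu : probability (full_shift A) R) : ergodic mu -> max_entropy_measure X mu ->
    exists e S, [/\ 0 < e, syndetic S & charges_words G mu e S].
  move=> emu mmu; have [e [e0 [S [synS hS]]]] := hmu mu emu mmu.
  exists e, S; split => // n Sn; rewrite -lte_fin -prE; last exact: measurable_window.
  apply: lt_le_trans (hS n Sn) _; rewrite /measure_of_words; have mX := measurable_subshift hX.
  have -> : \bigcup_(w in words_of_length G n) cylinder X w = window 1 n G `&` X.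
    apply/seteqP; split => [x [w [Gw sw] [Xx xw]]|x [Gx Xx]].
      by split => //; rewrite /window /= -sw xw.
    by exists (subword x 1 n); rewrite /cylinder /words_of_length /= size_subword.
  apply: le_measure; rewrite ?inE; last exact: subIsetl.
    by apply: measurableI => //; exact: measurable_window.
  exact: measurable_window.
have uniq (mu nu : probability (full_shift A) R) : ergodic mu -> max_entropy_measure X mu ->
    ergodic nu -> max_entropy_measure X nu -> same_measure mu nu.
  move=> emu mmu enu mnu.
  have [e1 [S1 [e10 syn1 h1]]] := charged mu emu mmu.
  have [e2 [S2 [e20 syn2 h2]]] := charged nu enu mnu.
  apply: (@ergodic_mme_same _ _ X hX C hC G gap hgap mu nu (Num.min e1 e2) S1 S2) => //.
  - by rewrite lt_min e10 e20.
  - by move=> n /h1; apply: le_lt_trans; rewrite ge_min lexx.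
  - by move=> n /h2; apply: le_lt_trans; rewrite ge_min lexx orbT.
have erg := mme_ergodic hX hC uniq.
have [mu mmu] := mme_exists hX hC.
exists mu; split => // nu mnu.
by apply: uniq => //; exact: erg.
Qed.
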